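(* Let $P$ be a finite Eulerian binomial poset of odd rank $n=2m+1\geq 5$. Then there is a positive integer $k$ such that either $P\cong \boxplus^k(B_n)$ or $P\cong\boxplus^k(T_n)$.
   Context: A finite graded poset with minimum $\hat 0$ and maximum $\hat 1$ is Eulerian if every interval $[x,y]$ with $x<y$ has as many elements of even rank as of odd rank. A finite binomial poset is a finite poset with $\hat 0$ and $\hat 1$ in which every interval is graded and any two intervals $[x,y]$ of the same length $n=\rho(y)-\rho(x)$ have the same number $B(n)$ of maximal chains. The boolean lattice $B_n$ is the poset of subsets of $\{1,\dots,n\}$ ordered by inclusion. The butterfly poset $T_n$ of rank $n$ consists of $\hat 0$, $\hat 1$ and the elements $(k,i)$ with $1\le k\le n-1$, $i\in\{1,2\}$, ordered by $\hat 0<(k,i)<\hat 1$ and $(k,i)\prec (k+1,j)$ for all $i,j$. For a poset $Q$ with unique minimum and maximum and a positive integer $k$, the $k$-summation $\boxplus^k(Q)$ is the poset obtained from $k$ disjoint copies of $Q$ by identifying all their minimum elements into one element and all their maximum elements into one element. *)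

(* Defs.v *)
From HB Require Import structures.
From mathcomp Require Import all_boot all_order.

Set Implicit Arguments.
Unset Strict Implicit.
Unset Printing Implicit Defensive.

Import Order.TTheory.

Local Open Scope order_scope.

Section FinitePosets.
Context {d : Order.disp_t} {P : finTBPOrderType d}.
Implicit Types (x y z : P) (C : {set P}).

Definition interval x y : {set P} := [set z | x <= z <= y].

Definition is_chain C : bool := [forall u in C, forall v in C, u >=< v].

Definition max_chains x y : {set {set P}} :=
  [set C | maxset [pred C' : {set P} | (C' \subset interval x y) && is_chain C'] C].

Definition graded_interval x y : Prop :=
  {in max_chains x y &, forall C C', #|C| = #|C'|}.

(* The length #|C| - 1 of a maximal chain C of [\bot, x]. In a graded poset
   all these lengths agree, and the maximum only serves to select their
   common value. *)
Definition rank x : nat := (\max_(C in max_chains \bot x) #|C|.-1)%N.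

End FinitePosets.

Definition eulerian {d : Order.disp_t} (P : finTBPOrderType d) : Prop :=
  graded_interval (\bot : P) \top /\
  forall x y : P, x < y ->
    #|[set z in interval x y | ~~ odd (rank z)]| =
    #|[set z in interval x y | odd (rank z)]|.

Definition binomial_poset {d : Order.disp_t} (P : finTBPOrderType d) : Prop :=
  (forall x y : P, x <= y -> graded_interval x y) /\
  forall x y x' y' : P, x <= y -> x' <= y' ->
    (rank y - rank x = rank y' - rank x')%N ->
    #|max_chains x y| = #|max_chains x' y'|.

Definition order_isomorphic {d d' : Order.disp_t}
    (P : porderType d) (Q : porderType d') : Prop :=
  exists2 f : P -> Q, bijective f & {mono f : x y / x <= y}.

Section BooleanLattice.
Variable n : nat.

Definition boolean_lattice : Type := {set 'I_n}.

HB.instance Definition _ := Finite.copy boolean_lattice {set 'I_n}.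

Definition boolean_le (A B : boolean_lattice) : bool := A \subset B.

Fact boolean_le_refl : reflexive boolean_le.
Proof. by move=> A; apply: subxx. Qed.

Fact boolean_le_anti : antisymmetric boolean_le.
Proof. by move=> A B leAB; apply/eqP; rewrite eqEsubset. Qed.

Fact boolean_le_trans : transitive boolean_le.
Proof. by move=> B A C; apply: subset_trans. Qed.

HB.instance Definition _ := Order.Le_isPOrder.Build
  Order.SetSubsetOrder.subset_display boolean_lattice
  boolean_le_refl boolean_le_anti boolean_le_trans.

Fact boolean_le0x (A : boolean_lattice) : (set0 : boolean_lattice) <= A.
Proof. exact: sub0set. Qed.

Fact boolean_lex1 (A : boolean_lattice) : A <= (setT : boolean_lattice).
Proof. exact: subsetT. Qed.

HB.instance Definition _ := Order.hasBottom.Build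
  Order.SetSubsetOrder.subset_display boolean_lattice boolean_le0x.
HB.instance Definition _ := Order.hasTop.Build
  Order.SetSubsetOrder.subset_display boolean_lattice boolean_lex1.

End BooleanLattice.

Fact butterfly_display : Order.disp_t. Proof. exact: Order.Disp tt tt. Qed.

Section Butterfly.
Variable n : nat.

(* An element (k, b) has rank k, where 0 <= k <= n. The boolean tells apart the
   two elements of each rank 0 < k < n; it is forced to be false when k = 0 or
   k = n, so that these ranks contain a single element. *)
Record butterfly : Type := Butterfly {
  butterfly_val : 'I_n.+1 * bool;
  _ : (0 < butterfly_val.1 < n)%N || ~~ butterfly_val.2 }.

HB.instance Definition _ := [isSub for butterfly_val].
HB.instance Definition _ := [Finite of butterfly by <:].

(* The reflexive transitive closure of the covers (k, b) < (k + 1, b'). *)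
Definition butterfly_le (p q : butterfly) : bool :=
  (p == q) || ((val p).1 < (val q).1)%N.

Fact butterfly_le_refl : reflexive butterfly_le.
Proof. by move=> p; rewrite /butterfly_le eqxx. Qed.

Fact butterfly_le_anti : antisymmetric butterfly_le.
Proof.
move=> p q /andP[/orP[/eqP-> //|lt_pq] /orP[/eqP-> //|lt_qp]].
by have := ltn_trans lt_pq lt_qp; rewrite ltnn.
Qed.

Fact butterfly_le_trans : transitive butterfly_le.
Proof.
move=> q p r /orP[/eqP-> //|lt_pq] /orP[/eqP<-|lt_qr].
  by rewrite /butterfly_le lt_pq orbT.
by rewrite /butterfly_le (ltn_trans lt_pq lt_qr) orbT.
Qed.

HB.instance Definition _ := Order.Le_isPOrder.Build butterfly_display butterfly
  butterfly_le_refl butterfly_le_anti butterfly_le_trans.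

Definition butterfly_bot : butterfly :=
  @Butterfly (ord0, false) (orbT _).

Definition butterfly_top : butterfly :=
  @Butterfly (ord_max, false) (orbT _).

Fact butterfly_le0x (p : butterfly) : butterfly_bot <= p.
Proof.
apply/orP; case: p => -[[k lt_k] b] kP /=.
have [k0|k_gt0] := posnP k; [left | by right].
have b0 : b = false by move: kP; rewrite /= k0 => /negbTE.
by apply/eqP/val_inj/eqP; rewrite xpair_eqE -val_eqE /= b0 k0 !eqxx.
Qed.

Fact butterfly_lex1 (p : butterfly) : p <= butterfly_top.
Proof.
apply/orP; case: p => -[[k lt_k] b] kP /=.
have [lt_kn|le_nk] := ltnP k n; [by right | left].
have Dk : k = n by apply/eqP; rewrite eqn_leq le_nk -ltnS lt_k.
have b0 : b = false.
  by move: kP; rewrite /= [(k < n)%N]ltnNge le_nk andbF => /negbTE.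
by apply/eqP/val_inj/eqP; rewrite xpair_eqE -val_eqE /= b0 Dk !eqxx.
Qed.

HB.instance Definition _ :=
  Order.hasBottom.Build butterfly_display butterfly butterfly_le0x.
HB.instance Definition _ :=
  Order.hasTop.Build butterfly_display butterfly butterfly_lex1.

End Butterfly.

Fact ksum_display : Order.disp_t. Proof. exact: Order.Disp tt tt. Qed.

Section KSummation.
Context {d : Order.disp_t}.
Variables (k : nat) (Q : finTBPOrderType d).

(* The pair (i, q) is the element q of the i-th copy of Q. Only copy 0 keeps
   its \bot and \top, which represent the identified minima and maxima. *)
Record ksum : Type := KSum {
  ksum_val : 'I_k * Q;
  _ : (ksum_val.2 \in [:: \bot; \top]) ==> (ksum_val.1 == 0 :> nat) }.

HB.instance Definition _ := [isSub for ksum_val].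
HB.instance Definition _ := [Finite of ksum by <:].

Definition ksum_le (p q : ksum) : bool :=
  [|| (val p).2 == \bot, (val q).2 == \top
    | ((val p).1 == (val q).1) && ((val p).2 <= (val q).2)].

Fact ksum_le_refl : reflexive ksum_le.
Proof. by move=> p; rewrite /ksum_le eqxx lexx !orbT. Qed.

Fact ksum_le_anti : antisymmetric ksum_le.
Proof.
case=> -[i x] xP [[j y] yP] lexy; apply: val_inj => /=.
move: xP yP lexy; rewrite /ksum_le /= !inE.
have bot_top : \bot = \top :> Q -> forall z : Q, z = \bot.
  by move=> bt z; apply/eqP; rewrite -lex0 bt lex1.
move=> xP yP lexy.
have eq_xy : x = y.
  case/andP: lexy => /or3P[/eqP x0|/eqP y1|/andP[_ le_xy]].
  - case/or3P=> [/eqP y0|/eqP x1|/andP[_]]; first by rewrite x0.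
      by rewrite !(bot_top _ y) // -x1.
    by rewrite x0 lex0 => /eqP.
  - case/or3P=> [/eqP y0|/eqP x1|/andP[_]]; last by rewrite y1 le1x => /eqP.
      by rewrite !(bot_top _ x) // -y1.
    by rewrite x1.
  - case/or3P=> [/eqP y0|/eqP x1|/andP[_ le_yx]].
    + by move: le_xy; rewrite y0 lex0 => /eqP.
    + by move: le_xy; rewrite x1 le1x => /eqP.
    + by apply/le_anti; rewrite le_xy.
move: xP yP lexy; rewrite -{}eq_xy => xP yP lexx.
have [ext|] := boolP ((x == \bot) || (x == \top)).
  move: xP yP; rewrite ext /= => /eqP i0 /eqP j0.
  by congr (_, _); apply: val_inj; rewrite /= i0 j0.
rewrite negb_or => /andP[/negbTE x0 /negbTE x1].
by move: lexx; rewrite x0 x1 /= => /andP[/andP[/eqP-> _] _].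
Qed.

Fact ksum_le_trans : transitive ksum_le.
Proof.
case=> -[j y] yP [[i x] xP] [[l z] zP]; rewrite /ksum_le /=.
case/or3P=> [->//|/eqP y1|/andP[/eqP-> le_xy]].
  case/or3P=> [/eqP y0|->|/andP[_ le_yz]]; rewrite ?orbT //.
  + have -> : z = \top by apply/le_anti; rewrite lex1 -y1 y0 le0x.
    by rewrite eqxx orbT.
  + by move: le_yz; rewrite y1 le1x => ->; rewrite orbT.
case/or3P=> [/eqP y0|->|/andP[/eqP-> le_yz]]; rewrite ?orbT //.
  by move: le_xy; rewrite y0 lex0 => ->.
by rewrite eqxx (le_trans le_xy le_yz) !orbT.
Qed.

HB.instance Definition _ := Order.Le_isPOrder.Build ksum_display ksum
  ksum_le_refl ksum_le_anti ksum_le_trans.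

End KSummation.

(* Main.v *)
Require Import Defs.
From HB Require Import structures.
From mathcomp Require Import all_boot all_order.
From mathcomp Require Import ssralg ssrnum ssrint zify ring.

(** In a binomial poset all intervals of length [k] have the same number [A k]
of atoms, which is also their number of coatoms; hence the level sizes of an
interval are determined by [A], and the Euler relation in even length [N] links
[a = A (N - 1)] and [b = A N] to the smaller values of [A]. In length 4 it reads
[b (4 - a) = 4], so [(a, b)] is [(3, 4)] or [(2, 2)]. If [A k = k] for
[k <= N - 2] it reads [b (N - a) = N], and [N - 2 <= a <= b] forces [a = N - 1]
and [b = N]. If [A k = 2] for [2 <= k <= N - 2] it reads [b (4 - a) = 4] again,
and [a = 3] is impossible because the atoms of an interval of length [N - 1]
then come in pairs. Thus below the odd rank [n] of P either [A k = k] or [A k = 2].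

Call two atoms equivalent if they have a common upper bound below the top. In
the first case an element below the top is determined by its set of atoms, the
classes have [n] elements, and every proper subset of a class occurs; in the
second case the classes have 2 elements and each class lies below exactly two
elements of each rank. So the classes index copies of the boolean lattice,
respectively of the butterfly poset. *)

Set Implicit Arguments.
Unset Strict Implicit.
Unset Printing Implicit Defensive.

Import Order.TTheory.

(** * Maximal chains *)

Section MaximalChains.
Context {d : Order.disp_t} {P : finTBPOrderType d}.
Implicit Types (x y z t : P) (C : {set P}).
Local Open Scope order_scope.

Definition covers x y : bool := (x < y) && [forall z, ~~ (x < z < y)].

Lemma coversP x y :
  reflect (x < y /\ forall z, x < z -> z < y -> False) (covers x y).
Proof.
apply: (iffP andP) => -[lt_xy H]; split=> //.
  by move=> z xz zy; move/forallP/(_ z): H; rewrite xz zy.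
by apply/forallP=> z; apply/negP=> /andP[]; apply: H.
Qed.

Lemma covers_lt x y : covers x y -> x < y.
Proof. by case/andP. Qed.

(** Maximality can be tested one element at a time: if [t] lies in the interval and is comparable
    with all of [C], then [t |: C] is again a chain there. *)
Lemma max_chainsP x y C :
  reflect [/\ {in C, forall z, x <= z <= y},
              {in C &, forall u v, u >=< v} &
              forall t, x <= t <= y -> {in C, forall c, t >=< c} -> t \in C]
          (C \in max_chains x y).
Proof.
rewrite inE; apply: (iffP maxsetP) => /= [[/andP[sC chC] maxC]|[sC chC maxC]].
  have {}sC : {in C, forall z, x <= z <= y}.
    by move=> z /(subsetP sC); rewrite inE.
  have {}chC : {in C &, forall u v, u >=< v}.
    by move=> u v uC vC; move/forall_inP: chC => /(_ u uC)/forall_inP/(_ v vC).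
  split=> // t xty cmp; rewrite -(maxC (t |: C)) ?setU11 ?subsetUr //=.
  apply/andP; split.
    by apply/subsetP=> z; rewrite !inE => /predU1P[->|/sC].
  apply/forall_inP=> u; rewrite !inE => /predU1P[->|uC].
    apply/forall_inP=> v; rewrite !inE => /predU1P[->|vC]; first exact: comparablexx.
    exact: cmp.
  apply/forall_inP=> v; rewrite !inE => /predU1P[->|vC]; last exact: chC.
  by rewrite comparable_sym cmp.
split=> [|D /andP[sD chD] sCD].
  apply/andP; split; first by apply/subsetP=> z /sC; rewrite inE.
  by apply/forall_inP=> u uC; apply/forall_inP=> v vC; apply: chC.
apply/eqP; rewrite eqEsubset sCD andbT; apply/subsetP=> t tD; apply: maxC.
  by move/(subsetP sD): tD; rewrite inE.
by move=> c /(subsetP sCD) cD; move/forall_inP: chD => /(_ t tD)/forall_inP; apply.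
Qed.

Lemma max_chains_bot x y C : x <= y -> C \in max_chains x y -> x \in C.
Proof.
move=> xy /max_chainsP[sC _]; apply; first by rewrite lexx.
by move=> c /sC/andP[xc _]; rewrite /Order.comparable xc.
Qed.


Lemma max_chains_cons x y z C : z <= y ->
  covers x z -> C \in max_chains z y -> x |: C \in max_chains x y.
Proof.
move=> zy /coversP[xz covxz] CP; have zC := max_chains_bot zy CP.
case/max_chainsP: CP => sC chC maxC.
have leC c : c \in C -> x <= c by case/sC/andP=> zc _; apply: le_trans (ltW xz) zc.
apply/max_chainsP; split.
- move=> t /setU1P[->|tC]; last by case/andP: (sC t tC) => _ ->; rewrite leC.
  by rewrite lexx (le_trans (ltW xz)).
- move=> u v /setU1P[->|uC] /setU1P[->|vC].
  + exact: comparablexx.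
  + by rewrite /Order.comparable leC.
  + by rewrite /Order.comparable leC ?orbT.
  + exact: chC.
move=> t /andP[xt ty] cmp; rewrite !inE.
have [//|t'x /=] := eqVneq t x.
apply: maxC => [|c cC]; last by apply: cmp; rewrite !inE cC orbT.
rewrite ty andbT; have := cmp z; rewrite !inE zC orbT => /(_ isT)/orP[|//].
rewrite le_eqVlt => /predU1P[->//|tz]; case: (covxz t) => //.
by rewrite lt_neqAle eq_sym t'x.
Qed.

Lemma max_chains_uncons x y C : x < y -> C \in max_chains x y ->
  exists z, [/\ covers x z, z <= y & C :\ x \in max_chains z y].
Proof.
move=> xy CP; have xC := max_chains_bot (ltW xy) CP.
case/max_chainsP: CP => sC chC maxC.
have yC : y \in C.
  apply: maxC => [|c /sC/andP[_ cy]]; first by rewrite lexx ltW.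
  by rewrite /Order.comparable cy orbT.
have yD : y \in C :\ x by rewrite !inE yC gt_eqF.
(* The least element of [C :\ x] is found by minimizing the size of the down-set, which grows
   strictly along the chain. *)
case: (@arg_minnP _ y (fun t => t \in C :\ x) (fun t => #|[set s | s <= t]|) yD) => z zD minz.
have {}minz t : t \in C :\ x -> z <= t.
  move=> tD; have /orP[//|] : z >=< t.
    by move: zD tD; rewrite !inE => /andP[_ zC] /andP[_ tC]; apply: chC.
  rewrite le_eqVlt => /predU1P[->//|tz]; have := minz t tD; rewrite leqNgt.
  case/negP; apply: proper_card; apply/properP; split.
    by apply/subsetP=> s; rewrite !inE => /le_trans; apply; apply: ltW.
  by exists z; rewrite !inE ?lexx // lt_geF.
have [z'x zC] := setD1P zD; have /andP[xz zy] := sC z zC.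
have {z'x}xz : x < z by rewrite lt_neqAle eq_sym z'x.
exists z; split=> //.
  apply/coversP; split=> // t xt tz; have: t \in C.
    apply: maxC => [|c cC]; first by rewrite ltW //= (le_trans (ltW tz)).
    have [->|c'x] := eqVneq c x; first by rewrite /Order.comparable (ltW xt) orbT.
    by rewrite /Order.comparable (le_trans (ltW tz)) // minz // !inE c'x.
  by move=> tC; have := minz t; rewrite !inE gt_eqF // tC lt_geF // => /(_ isT).
apply/max_chainsP; split=> [t tD|u v|t /andP[zt ty] cmp].
- by rewrite minz //; case/setD1P: tD => _ /sC/andP[].
- by rewrite !inE => /andP[_ uC] /andP[_ vC]; apply: chC.
rewrite !inE gt_eqF ?(lt_le_trans xz) //=; apply: maxC => [|c cC].
  by rewrite ty (le_trans (ltW xz)).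
have [->|c'x] := eqVneq c x; last by apply: cmp; rewrite !inE c'x.
by rewrite /Order.comparable (le_trans (ltW xz)) ?orbT.
Qed.

Lemma max_chainsxx x : max_chains x x = [set [set x]].
Proof.
apply/setP=> C; apply/idP/set1P=> [CP|->].
  have xC := max_chains_bot (lexx x) CP; case/max_chainsP: CP => sC _ _.
  apply/eqP; rewrite eqEsubset sub1set xC andbT; apply/subsetP=> z /sC.
  by rewrite inE => /le_anti->.
apply/max_chainsP; split=> [z /set1P->|u v /set1P-> /set1P->|t /le_anti<- _].
- by rewrite lexx.
- exact: comparablexx.
exact: set11.
Qed.

Lemma exists_atom x y : x < y -> exists2 z, covers x z & z <= y.
Proof.
move=> xy; have yP : x < y <= y by rewrite xy lexx.
case: (@arg_minnP _ y (fun t => x < t <= y) (fun t => #|[set s | s <= t]|) yP) => z /andP[xz zy] minz.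
exists z => //; apply/coversP; split=> // t xt tz.
have := minz t; rewrite xt (le_trans (ltW tz) zy) => /(_ isT); rewrite leqNgt.
case/negP; apply: proper_card; apply/properP; split.
  by apply/subsetP=> s; rewrite !inE => /le_trans; apply; apply: ltW.
by exists z; rewrite !inE ?lexx // lt_geF.
Qed.

Definition atoms_in x y : {set P} := [set z | covers x z && (z <= y)].

Definition coatoms_in x y : {set P} := [set z | (x <= z) && covers z y].

Lemma notin_max_chains x y z C : covers x z -> C \in max_chains z y -> x \notin C.
Proof.
move=> xz /max_chainsP[sC _ _]; apply/negP=> /sC/andP[zx _].
by have := lt_le_trans (covers_lt xz) zx; rewrite ltxx.
Qed.

Lemma card_max_chains x y : x < y ->
  #|max_chains x y| = (\sum_(z in atoms_in x y) #|max_chains z y|)%N.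
Proof.
move=> xy.
have -> : max_chains x y =
    \bigcup_(z in atoms_in x y) ((fun C => x |: C) @: max_chains z y).
  apply/setP=> C; apply/idP/bigcupP=> [CP|[z]].
    have [z [xz zy CzP]] := max_chains_uncons xy CP.
    exists z; first by rewrite inE xz.
    apply/imsetP; exists (C :\ x) => //.
    by rewrite setD1K // (max_chains_bot (ltW xy)).
  rewrite inE => /andP[xz zy] /imsetP[D DP ->]; exact: max_chains_cons DP.
have injU z : z \in atoms_in x y ->
    {in max_chains z y &, injective (fun C => x |: C)}.
  rewrite inE => /andP[xz _] C D /(notin_max_chains xz) xC /(notin_max_chains xz) xD.
  by move/(congr1 (fun E => E :\ x)); rewrite !setU1K.
pose F z := if z \in atoms_in x y then (fun C => x |: C) @: max_chains z y else set0.
rewrite big_mkcond -/F -sum1_card partition_disjoint_bigcup => [|z z' z'z].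
  rewrite [RHS]big_mkcond; apply: eq_bigr => z _; rewrite sum1_card /F.
  by case: ifP => [/injU/card_in_imset->//|]; rewrite cards0.
rewrite -setI_eq0; apply/eqP/setP=> C; rewrite !inE; apply/negP; rewrite /F.
case: ifP; rewrite ?inE // => /andP[xz zy]; case: ifP; rewrite ?inE ?andbF //.
case/andP=> xz' zy' /andP[/imsetP[D DP ->] /imsetP[D' DP' /(congr1 (fun E => E :\ x))]].
rewrite !setU1K ?(notin_max_chains xz DP) ?(notin_max_chains xz' DP') // => eqD.
subst D'; case/eqP: z'z; apply: le_anti.
have := max_chains_bot zy DP; have := max_chains_bot zy' DP'.
case/max_chainsP: DP => sD _ _; case/max_chainsP: DP' => sD' _ _.
by move=> /sD/andP[-> _] /sD'/andP[-> _].
Qed.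

(** Descending induction along covers. The measure is the size of the interval, since [[z, y]] no
    longer contains [x]; this makes it available before ranks are understood. *)
Lemma interval_ind y (Q : P -> Prop) : Q y ->
    (forall x, x < y -> (forall z, covers x z -> z <= y -> Q z) -> Q x) ->
  forall x, x <= y -> Q x.
Proof.
move=> Qy Qlt x; move: {2}_.+1 (ltnSn #|interval x y|) => k.
elim: k x => // k IHk x ltk; rewrite le_eqVlt => /predU1P[->//|xy].
apply: Qlt => // z xz zy; apply: IHk => //; apply: leq_trans (ltk : (_ <= k)%N).
apply: proper_card; apply/properP; split.
  apply/subsetP=> t; rewrite !inE => /andP[zt ->]; rewrite andbT.
  exact: le_trans (ltW (covers_lt xz)) zt.
by exists x; rewrite !inE ?lexx ?(ltW xy) // lt_geF // covers_lt.
Qed.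

Lemma max_chains_gt0 x y : x <= y -> (0 < #|max_chains x y|)%N.
Proof.
elim/interval_ind: x / => [|x xy IH]; first by rewrite max_chainsxx cards1.
have [z xz zy] := exists_atom xy; have /card_gt0P[C CP] := IH z xz zy.
by apply/card_gt0P; exists (x |: C); apply: max_chains_cons CP.
Qed.

Lemma covers_eq x y z : covers x y -> x < z -> z <= y -> z = y.
Proof.
move=> /coversP[_ cov] xz; rewrite le_eqVlt => /predU1P[//|zy].
by case: (cov z).
Qed.

Lemma atoms_in_covers x y : covers x y -> atoms_in x y = [set y].
Proof.
move=> xy; apply/setP=> z; rewrite !inE; apply/andP/eqP=> [[xz zy]|->].
  exact: covers_eq xy (covers_lt xz) zy.
by rewrite xy lexx.
Qed.

Lemma coatoms_in_covers x y : covers x y -> coatoms_in x y = [set x].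
Proof.
move=> xy; apply/setP=> z; rewrite !inE; apply/andP/eqP=> [[]|->].
  rewrite le_eqVlt => /predU1P[//|xz] zy; have := covers_lt zy.
  by rewrite (covers_eq xy xz (ltW (covers_lt zy))) ltxx.
by rewrite xy lexx.
Qed.

(** Split off an atom, then by induction a coatom, exchange the two sums, and regroup the atoms. The
    covers are treated apart because there the only atom is [y] itself. *)
Lemma card_max_chains_rev x y : x < y ->
  #|max_chains x y| = (\sum_(z in coatoms_in x y) #|max_chains x z|)%N.
Proof.
move=> xy; move: (ltW xy) (xy) => {xy}.
elim/interval_ind: x / => [|x _ IH xy].
  by rewrite ltxx.
have [cov|ncov] := boolP (covers x y).
  rewrite card_max_chains // atoms_in_covers // coatoms_in_covers // !big_set1.
  by rewrite !max_chainsxx !cards1.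
rewrite card_max_chains //.
transitivity (\sum_(z in atoms_in x y) \sum_(w in coatoms_in z y) #|max_chains z w|)%N.
  apply: eq_bigr => z; rewrite inE => /andP[xz zy]; apply: IH => //.
  by rewrite lt_neqAle zy andbT; apply: contraNneq ncov => <-.
rewrite (exchange_big_dep (fun w => w \in coatoms_in x y)) /=; last first.
  move=> z w; rewrite !inE => /andP[xz _] /andP[zw ->].
  by rewrite (le_trans (ltW (covers_lt xz))).
apply: eq_bigr => w; rewrite inE => /andP[xw wy].
rewrite card_max_chains; last first.
  by rewrite lt_neqAle xw andbT; apply: contraNneq ncov => ->.
apply: eq_bigl => z; rewrite !inE wy andbT -andbA; congr (_ && _).
apply/andP/idP=> [[]//|zw]; split=> //.
exact: le_trans zw (ltW (covers_lt wy)).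
Qed.

(** Taken at [x = \bot], this makes the rank grow by exactly one along a cover. *)
Lemma max_chains_rcons x y z C : x <= z -> covers z y -> C \in max_chains x z ->
  exists2 D, D \in max_chains x y & #|D| = #|C|.+1.
Proof.
move=> xz zy; elim/interval_ind: x / xz C => [|x xz IH] C.
  rewrite max_chainsxx => /set1P->; exists (z |: [set y]).
    by apply: max_chains_cons zy _ => //; rewrite max_chainsxx set11.
  by rewrite cardsU1 !cards1 inE lt_eqF // covers_lt.
move=> CP; have xC := max_chains_bot (ltW xz) CP.
have [t [xt tz tP]] := max_chains_uncons xz CP.
have [D DP cD] := IH t xt tz _ tP; exists (x |: D).
  exact: max_chains_cons (le_trans tz (ltW (covers_lt zy))) xt DP.
by rewrite cardsU1 cD (notin_max_chains xt DP) (cardsD1 x C) xC.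
Qed.

End MaximalChains.

(** * Rank and atom numbers of binomial posets *)

Section BinomialPosets.
Context {d : Order.disp_t} {P : finTBPOrderType d}.
Implicit Types (x y z t u v w : P) (C : {set P}).
Local Open Scope order_scope.
Hypothesis binP : binomial_poset P.

Lemma rank_max_chains x C : C \in max_chains \bot x -> rank x = #|C|.-1.
Proof.
move=> CP; apply/eqP; rewrite eqn_leq; apply/andP; split.
  by apply/bigmax_leqP => D DP; rewrite (binP.1 \bot x (le0x x) D C).
exact: (@leq_bigmax_cond _ (fun D => D \in max_chains \bot x) (fun D => #|D|.-1)).
Qed.

Lemma rank_bot : rank (\bot : P) = 0%N.
Proof.
by rewrite (@rank_max_chains \bot [set \bot]) ?cards1 // max_chainsxx set11.
Qed.

Lemma rank_covers x y : covers x y -> rank y = (rank x).+1.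
Proof.
move=> xy; have /card_gt0P[C CP] := max_chains_gt0 (le0x x).
have [D DP cD] := max_chains_rcons (le0x x) xy CP.
rewrite (rank_max_chains CP) (rank_max_chains DP) cD prednK // card_gt0.
by apply/set0Pn; exists \bot; apply: max_chains_bot CP.
Qed.

Lemma le_rank x y : x <= y -> (rank x <= rank y)%N.
Proof.
elim/(@interval_ind _ P): x / => // x xy IH; have [z xz zy] := exists_atom xy.
by apply: leq_trans (IH z xz zy); rewrite (rank_covers xz).
Qed.

Lemma lt_rank x y : x < y -> (rank x < rank y)%N.
Proof.
move=> xy; have [z xz zy] := exists_atom xy.
by rewrite -(rank_covers xz) le_rank.
Qed.

Lemma le_rank_eq x y : x <= y -> (rank y <= rank x)%N -> x = y.
Proof.
by rewrite le_eqVlt => /predU1P[//|/lt_rank]; rewrite ltnNge => /negbTE->.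
Qed.

Lemma covers_rank x y : covers x y = (x <= y) && (rank y == (rank x).+1).
Proof.
apply/idP/andP=> [xy|[xy /eqP rxy]].
  by rewrite ltW ?covers_lt // (rank_covers xy).
have ltxy : x < y.
  by rewrite lt_neqAle xy andbT; apply/eqP => e; move: rxy; rewrite e; lia.
have [z xz zy] := exists_atom ltxy; rewrite -(le_rank_eq zy) //.
by rewrite (rank_covers xz) rxy.
Qed.

Lemma exists_rank x y j : x <= y -> (rank x <= j <= rank y)%N ->
  exists z, [/\ x <= z, z <= y & rank z = j].
Proof.
elim/(@interval_ind _ P): x / => [|x xy IH] rj; first by exists y; split=> //; lia.
have [<-|xj] := eqVneq (rank x) j; first by exists x; rewrite lexx ltW.
have [z xz zy] := exists_atom xy; have rz := rank_covers xz.
case: (IH z xz zy) => [|t [zt ty rt]]; first lia.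
by exists t; split=> //; apply: le_trans zt; apply: ltW; apply: covers_lt.
Qed.

Lemma atoms_inE x y z :
  (z \in atoms_in x y) = [&& x <= z, z <= y & rank z == (rank x).+1].
Proof. by rewrite inE covers_rank -andbA [(z <= y) && _]andbC. Qed.

Lemma coatoms_inE x y z :
  (z \in coatoms_in x y) = [&& x <= z, z <= y & rank y == (rank z).+1].
Proof. by rewrite inE covers_rank. Qed.

(** The binomial property enters here: the intervals [[z, y]] above the atoms [z] all have the
    length of [[u, v]], hence equally many maximal chains. *)
Lemma card_max_chains_atoms x y u v : x < y -> u <= v ->
    (rank v - rank u = (rank y - rank x).-1)%N ->
  #|max_chains x y| = (#|atoms_in x y| * #|max_chains u v|)%N.
Proof.
move=> xy uv r; rewrite card_max_chains // -sum_nat_const.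
apply: eq_bigr => z; rewrite atoms_inE => /and3P[_ zy /eqP rz].
by apply: binP.2 => //; rewrite rz; lia.
Qed.

Lemma card_max_chains_coatoms x y u v : x < y -> u <= v ->
    (rank v - rank u = (rank y - rank x).-1)%N ->
  #|max_chains x y| = (#|coatoms_in x y| * #|max_chains u v|)%N.
Proof.
move=> xy uv r; rewrite card_max_chains_rev // -sum_nat_const.
apply: eq_bigr => z; rewrite coatoms_inE => /and3P[xz _ /eqP rz].
by apply: binP.2 => //; rewrite r rz; have := le_rank xz; lia.
Qed.

Lemma atoms_inxx x : atoms_in x x = set0.
Proof.
apply/setP=> z; rewrite inE in_set0; apply/negP=> /andP[/covers_lt xz].
by rewrite lt_geF.
Qed.

Lemma coatoms_inxx x : coatoms_in x x = set0.
Proof.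
apply/setP=> z; rewrite inE in_set0; apply/negP=> /andP[xz /covers_lt].
by rewrite le_gtF.
Qed.

(** In length [k > 0] the number of atoms is the quotient B(k) / B(k - 1), where B(j) is the number
    of maximal chains in length [j]. *)
Lemma eq_card_atoms x y u v : x <= y -> u <= v ->
  (rank y - rank x = rank v - rank u)%N -> #|atoms_in x y| = #|atoms_in u v|.
Proof.
move=> + + r; rewrite le_eqVlt => /predU1P[xy|xy] uv.
  have uv' : u = v by apply: le_rank_eq => //; move: r; rewrite xy; lia.
  by rewrite xy uv' !atoms_inxx !cards0.
have {}uv : u < v.
  rewrite lt_neqAle uv andbT; apply/eqP=> e; have := lt_rank xy.
  by move: r; rewrite e; lia.
have [z xz zy] := exists_atom xy; have rz := rank_covers xz.
have r1 : (rank y - rank z = (rank y - rank x).-1)%N by rewrite rz; lia.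
have e1 := card_max_chains_atoms xy zy r1.
have e2 := @card_max_chains_atoms u v z y uv zy _.
apply/eqP; rewrite -(eqn_pmul2r (max_chains_gt0 zy)) -e1 -e2 -?r //.
by apply/eqP/binP.2 => //; apply: ltW.
Qed.

(** Splitting maximal chains at the top instead of the bottom gives the same quotient of chain
    numbers. *)
Lemma eq_card_coatoms x y : x <= y -> #|coatoms_in x y| = #|atoms_in x y|.
Proof.
rewrite le_eqVlt => /predU1P[->|xy]; first by rewrite coatoms_inxx atoms_inxx.
have [z xz zy] := exists_atom xy; have rz := rank_covers xz.
have r1 : (rank y - rank z = (rank y - rank x).-1)%N by rewrite rz; lia.
apply/eqP; rewrite -(eqn_pmul2r (max_chains_gt0 zy)).
by rewrite -card_max_chains_atoms // -card_max_chains_coatoms.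
Qed.

(* The number of atoms is the same for all intervals of length k (eq_card_atoms):
   the maximum only selects this common value. *)
Definition atom_number (k : nat) : nat :=
  (\max_(p : P * P | (p.1 <= p.2)%O && (rank p.2 - rank p.1 == k))
     #|atoms_in p.1 p.2|)%N.

Local Notation A := atom_number.

Lemma card_atoms x y : x <= y -> #|atoms_in x y| = A (rank y - rank x).
Proof.
move=> xy; apply/eqP; rewrite eqn_leq; apply/andP; split.
  apply: (@leq_bigmax_cond _ _ (fun p : P * P => #|atoms_in p.1 p.2|) (x, y)).
  by rewrite /= xy eqxx.
apply/bigmax_leqP => -[u v] /= /andP[uv /eqP r].
by rewrite (@eq_card_atoms u v x y).
Qed.

Lemma card_coatoms x y : x <= y -> #|coatoms_in x y| = A (rank y - rank x).
Proof. by move=> xy; rewrite eq_card_coatoms ?card_atoms. Qed.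

Lemma atom_number1 : (0 < rank (\top : P))%N -> A 1 = 1%N.
Proof.
move=> r; have [|x [_ _ rx]] := @exists_rank \bot \top 1 (le0x _).
  by rewrite rank_bot; lia.
have cov : covers \bot x by rewrite covers_rank le0x rx rank_bot.
have := card_atoms (le0x x); rewrite rx rank_bot subn0 => <-.
by rewrite atoms_in_covers ?cards1.
Qed.

Lemma atom_number_leS k : (0 < k < rank (\top : P))%N -> (A k <= A k.+1)%N.
Proof.
move=> kn; have [|y [_ _ ry]] := @exists_rank \bot \top k.+1 (le0x _).
  by rewrite rank_bot; lia.
have [|x [_ xy rx]] := @exists_rank \bot y k (le0x _).
  by rewrite rank_bot ry; lia.
have := card_atoms (le0x x); have := card_atoms (le0x y).
rewrite rx ry rank_bot !subn0 => <- <-; apply/subset_leq_card/subsetP => z.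
by rewrite !atoms_inE => /and3P[-> /le_trans->].
Qed.

Definition level x y (j : nat) : {set P} :=
  [set z in interval x y | rank z == (rank x + j)%N].

Lemma levelE x y j z :
  (z \in level x y j) = [&& x <= z, z <= y & rank z == (rank x + j)%N].
Proof. by rewrite !inE andbA. Qed.

Lemma level1 x y : level x y 1 = atoms_in x y.
Proof. by apply/setP=> z; rewrite levelE atoms_inE addn1. Qed.

(** Double counting of the pairs [u <= v] on two consecutive levels: [u] has [A (k - j)] covers
    inside [[u, y]], and [v] has [A j.+1] coatoms inside [[x, v]]. *)
Lemma level_mul x y k j : x <= y -> (rank y - rank x = k)%N -> (j < k)%N ->
  (#|level x y j| * A (k - j) = #|level x y j.+1| * A j.+1)%N.
Proof.
move=> xy rk jk.
transitivity (\sum_(u in level x y j) \sum_(v in level x y j.+1 | (u <= v)%O) 1)%N.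
  rewrite -sum_nat_const; apply: eq_bigr => u.
  rewrite levelE => /and3P[xu uy /eqP ru].
  have -> : (k - j = rank y - rank u)%N by lia.
  rewrite -card_atoms // sum1dep_card; apply: eq_card => v.
  rewrite [in RHS]inE levelE atoms_inE ru addnS.
  case uv: (u <= v) => /=; last by rewrite andbF.
  by rewrite (le_trans xu uv) andbT.
rewrite (exchange_big_dep (fun v => v \in level x y j.+1)) => [|u v _ /andP[]//] /=.
rewrite -sum_nat_const; apply: eq_bigr => v.
rewrite levelE => /and3P[xv vy /eqP rv].
have -> : A j.+1 = #|coatoms_in x v| by rewrite card_coatoms //; congr A; lia.
rewrite -sum1_card; apply: eq_bigl => u.
rewrite xv vy rv eqxx levelE coatoms_inE rv addnS eqSS [in RHS]eq_sym /=.
case xu: (x <= u) => //=; case uv: (u <= v); rewrite ?andbF ?andbT //=.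
by rewrite (le_trans uv vy).
Qed.

End BinomialPosets.

(** * Alternating sums *)

Section AlternatingSums.
Import GRing.Theory Num.Theory.
Local Open Scope ring_scope.

(** The two terms at each end are isolated because, for level sizes, they are 1 and the number of
    atoms, while the inner levels follow a uniform pattern. *)
Lemma alternating_sum_ends (F : nat -> int) (K : nat) : ~~ odd K ->
  \sum_(j < K.+4.+1) (-1) ^+ j * F j =
  F 0 - F 1 + \sum_(i < K.+1) (-1) ^+ i * F i.+2 - F K.+3 + F K.+4.
Proof.
move=> evK; rewrite 2![in LHS]big_ord_recr 2![in LHS]big_ord_recl /=.
have sgn i : (-1) ^+ i = (if odd i then -1 else 1) :> int by rewrite -signr_odd; case: odd.
rewrite expr0 !sgn /= !negbK (negbTE evK) /=.
under eq_bigr => i _ do rewrite /bump /= !add1n sgn /= negbK -sgn.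
by rewrite /bump /= !addn0; ring.
Qed.

Lemma alternating_sum_binomial N : (0 < N)%N ->
  \sum_(j < N.+1) (-1) ^+ j * 'C(N, j)%:Z = 0.
Proof.
move=> N_gt0; have := exprDn (1 : int) (-1) N; rewrite subrr expr0n.
rewrite eqn0Ngt N_gt0 => e; rewrite [RHS]e; apply: eq_bigr => j _.
by rewrite expr1n mul1r -mulr_natr natz.
Qed.

Lemma alternating_sum1 K : ~~ odd K -> \sum_(i < K.+1) (-1) ^+ i = 1 :> int.
Proof.
move=> evK; rewrite -(odd_double_half K) (negbTE evK) add0n.
elim: K./2 => [|i IH]; first by rewrite big_ord1.
by rewrite doubleS 2!big_ord_recr /= IH [X in _ + X]exprS mulN1r addrK.
Qed.

(** [W j] stands for the size of level [j] in an interval of length [N = K.+4], with [a = A (N - 1)]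
    and [b = A N]. The equation [W2] is the level relation between levels 1 and 2, using
    [A 2 = 2]. *)
Variables (W : nat -> nat) (K a b : nat).
Hypotheses (evK : ~~ odd K) (W0 : W 0 = 1%N) (W1 : W 1 = b) (W2 : (b * a = W 2 * 2)%N)
  (Wb : W K.+3 = b) (Wt : W K.+4 = 1%N)
  (eulW : \sum_(j < K.+4.+1) (-1) ^+ j * (W j)%:Z = 0).

(** There are oddly many inner levels, so their alternating sum is [W 2], that is, half of [a * b].
    The Euler relation then becomes 2 - 2b + ab/2 = 0. *)
Lemma euler_constant : (forall i, (i <= K)%N -> W i.+2 = W 2) ->
  (4 + a * b = 4 * b)%N.
Proof.
move=> Wi; move: eulW; rewrite (alternating_sum_ends (fun j => (W j)%:Z)) //.
have -> : \sum_(i < K.+1) (-1) ^+ i * (W i.+2)%:Z = (W 2)%:Z.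
  transitivity ((\sum_(i < K.+1) (-1) ^+ i) * (W 2)%:Z); last first.
    by rewrite alternating_sum1 // mul1r.
  rewrite mulr_suml.
  by apply: eq_bigr => i _; rewrite Wi // -ltnS ltn_ord.
by rewrite W0 W1 Wb Wt; lia.
Qed.

(** The inner levels are proportional to those of [c], which is meant to be the sequence of binomial
    coefficients. Comparing the two alternating sums eliminates the inner terms without evaluating
    them. *)
Lemma euler_binomial (c : nat -> nat) :
    c 0 = 1%N -> c 1 = K.+4 -> c K.+3 = K.+4 -> c K.+4 = 1%N ->
    (c 2 * 2 = K.+4 * K.+3)%N ->
    \sum_(j < K.+4.+1) (-1) ^+ j * (c j)%:Z = 0 ->
    (forall i, (i <= K)%N -> W i.+2 * c 2 = W 2 * c i.+2)%N ->
  (K.+4 + a * b = K.+4 * b)%N.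
Proof.
move=> c0 c1 cb ct c2 ES Wi; move: eulW ES.
rewrite (alternating_sum_ends (fun j => (W j)%:Z)) //.
rewrite (alternating_sum_ends (fun j => (c j)%:Z)) //.
rewrite W0 W1 Wb Wt c0 c1 cb ct.
set T := \sum_(i < _) _; set S := \sum_(i < _) _ => ET ES.
have ST : T * (c 2)%:Z = (W 2)%:Z * S.
  rewrite mulr_suml mulr_sumr; apply: eq_bigr => i _.
  by rewrite -mulrA -PoszM Wi 1?PoszM 1?mulrCA // -ltnS ltn_ord.
have HT : T = 2 * b%:Z - 2 by lia.
have HS : S = 2 * K.+3%:Z by lia.
move: ST; rewrite HT HS => ST.
(* With [N = K.+4], doubling [c 2] gives N(N - 1) and doubling [W 2] gives ab; the factor N - 1 is
   cancelled next. *)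
have e : (b%:Z - 1) * (K.+4%:Z * K.+3%:Z) = (b%:Z * a%:Z) * K.+3%:Z.
  rewrite -!PoszM W2 -c2 !PoszM.
  transitivity ((2 * b%:Z - 2) * (c 2)%:Z); first by ring.
  by rewrite ST; ring.
have {}e : (b%:Z - 1) * K.+4%:Z = b%:Z * a%:Z.
  by apply: (mulIf (x := K.+3%:Z)) => //; rewrite -mulrA.
apply/eqP; rewrite -eqz_nat; apply/eqP; rewrite !PoszD !PoszM.
by rewrite [a%:Z * _]mulrC -e; ring.
Qed.

End AlternatingSums.

(** * Butterfly intervals and the Euler relation *)

Section AtomNumbers.
Context {d : Order.disp_t} {P : finTBPOrderType d}.
Implicit Types (x y z t u v w : P).
Local Open Scope order_scope.
Hypothesis binP : binomial_poset P.
Local Notation A := (@atom_number _ P).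

Lemma level0 x y : x <= y -> level x y 0 = [set x].
Proof.
move=> xy; apply/setP=> z; rewrite levelE in_set1 addn0.
apply/and3P/eqP=> [[xz _ /eqP rz]|->]; last by rewrite lexx xy.
by apply/esym/(le_rank_eq binP xz); rewrite rz.
Qed.

Lemma level_top x y : x <= y -> level x y (rank y - rank x) = [set y].
Proof.
move=> xy; apply/setP=> z; rewrite levelE in_set1 subnKC ?(le_rank binP) //.
apply/and3P/eqP=> [[_ zy /eqP rz]|->]; last by rewrite lexx xy.
by apply/(le_rank_eq binP zy); rewrite rz.
Qed.

Section ButterflyIntervals.
Variable K : nat.
Hypothesis A2 : forall k, (2 <= k <= K)%N -> A k = 2.

(** Level 1 has 2 elements, and in the level relation between inner levels both factors are 2. *)
Lemma card_level_butterfly x y j : x <= y -> (rank y - rank x <= K)%N ->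
  (0 < j < rank y - rank x)%N -> #|level x y j| = 2.
Proof.
move=> xy lenK; elim: j => // -[_ len1|j IH lenj].
  by rewrite level1 // card_atoms // A2 //; lia.
have := @level_mul _ _ binP x y _ j.+1 xy (erefl _).
by rewrite IH ?(A2 (k := _ - _)) ?(A2 (k := j.+2)); lia.
Qed.

(** For [v] below [y], the level of [v] in [[u, y]] is contained in its level in [[x, y]], and both
    have two elements, so they agree. *)
Lemma le_butterfly x y u v : (rank y - rank x <= K)%N -> x <= u -> u <= y ->
  x <= v -> v <= y -> (rank u < rank v)%N -> u <= v.
Proof.
move=> lenK xu uy xv vy ruv; have xy := le_trans xu uy.
move: (vy); rewrite le_eqVlt => /predU1P[->//|/(lt_rank binP) rvy].
have rxu := le_rank binP xu.
have sub : level u y (rank v - rank u) \subset level x y (rank v - rank x).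
  apply/subsetP=> z; rewrite !levelE => /and3P[uz -> /eqP->].
  by rewrite (le_trans xu uz) /=; apply/eqP; lia.
have : v \in level x y (rank v - rank x).
  by rewrite levelE xv vy /=; apply/eqP; lia.
suff <- : level u y (rank v - rank u) = level x y (rank v - rank x).
  by rewrite levelE => /and3P[].
by apply/eqP; rewrite eqEcard sub !card_level_butterfly //; lia.
Qed.

End ButterflyIntervals.

(* For y = \top these are the equivalence classes of atoms. *)
Definition block y v : {set P} :=
  [set u | covers \bot u & [exists z, [&& u <= z, v <= z & z < y]]].

Lemma blockP y v u :
  reflect (covers \bot u /\ exists z, [/\ u <= z, v <= z & z < y]) (u \in block y v).
Proof.
rewrite inE; apply: (iffP andP) => -[cu]; first by move/existsP=> [z /and3P[]]; split=> //; exists z.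
by case=> z [uz vz zy]; split=> //; apply/existsP; exists z; apply/and3P.
Qed.

Lemma atom_rank u : covers \bot u = (rank u == 1)%N.
Proof. by rewrite covers_rank // le0x rank_bot. Qed.

Lemma mem_atoms u z : (u \in atoms_in \bot z) = (rank u == 1)%N && (u <= z).
Proof. by rewrite inE atom_rank. Qed.

(* All elements of rank 2 above v lie below one element t of rank 3, and t has
   only two atoms. *)
Lemma block_butterfly K y v z :
    (forall k, (2 <= k <= K)%N -> A k = 2) -> (3 <= K)%N -> rank y = K.+1 ->
    rank v = 1%N -> v <= z -> z < y -> (2 <= rank z)%N ->
  block y v = atoms_in \bot z.
Proof.
move=> A2 K3 ry rv vz zy rz.
have vy := le_trans vz (ltW zy).
have [|t [vt ty rt]] := @exists_rank _ _ binP v y 3 vy; first by rewrite rv ry; lia.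
have cA s : s < y -> (2 <= rank s)%N -> #|atoms_in \bot s| = 2.
  move=> /(lt_rank binP) sy rs; rewrite card_atoms ?le0x // rank_bot //.
  by apply: A2; lia.
have tlt : t < y by rewrite lt_neqAle ty andbT; apply/eqP => e; move: rt; rewrite e ry; lia.
have key s : v <= s -> s < y -> (2 <= rank s)%N -> atoms_in \bot s = atoms_in \bot t.
  move=> vs sy rs.
  have [|e [ve es re]] := @exists_rank _ _ binP v s 2 vs; first by rewrite rv.
  have et : e <= t.
    apply: (@le_butterfly K A2 v y) => //; last by rewrite re rt.
      by rewrite ry rv; lia.
    exact: le_trans es (ltW sy).
  have sub w : e <= w -> w < y -> (2 <= rank w)%N -> atoms_in \bot e = atoms_in \bot w.
    move=> ew wy rw; apply/eqP; rewrite eqEcard !cA ?re ?leqnn ?andbT //.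
      by apply/subsetP=> a; rewrite !mem_atoms => /andP[-> /le_trans->].
    exact: le_lt_trans ew wy.
  by rewrite -(sub s) // (sub t) // rt.
rewrite (key z) //; apply/setP=> u; apply/blockP/idP=> [[cu [s [us vs sy]]]|].
  have ru : rank u = 1%N by apply/eqP; rewrite -atom_rank.
  have [rs|rs] := leqP 2 (rank s); first by rewrite -(key s) // mem_atoms us ru.
  (* An [s] of rank at most 1 above the atoms [u] and [v] is equal to both. *)
  have <- : v = u.
    by rewrite (le_rank_eq binP vs) 1?(le_rank_eq binP us) // ?ru ?rv; lia.
  by rewrite mem_atoms rv vt.
rewrite mem_atoms => /andP[ru ut]; split; first by rewrite atom_rank.
by exists t.
Qed.

(** Below an element [y] of rank [K.+1] the classes of atoms are disjoint pairs, and two of them do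
    not fit into three atoms. *)
Lemma atom_number_neq3 K :
    (forall k, (2 <= k <= K)%N -> A k = 2) -> (3 <= K < rank (\top : P))%N ->
  A K.+1 <> 3.
Proof.
move=> A2 /andP[K3 Kn] A3.
have [|y [_ _ ry]] := @exists_rank _ _ binP \bot \top K.+1 (le0x _).
  by rewrite rank_bot.
have cy : #|atoms_in \bot y| = 3 by rewrite card_atoms ?le0x // rank_bot // ry subn0.
have above v : v \in atoms_in \bot y -> exists z, [/\ v <= z, z < y & rank z = 2].
  rewrite mem_atoms => /andP[/eqP rv vy].
  have [|z [vz zy rz]] := @exists_rank _ _ binP v y 2 vy; first by rewrite rv ry; lia.
  exists z; split=> //; rewrite lt_neqAle zy andbT; apply/eqP => e.
  by move: rz; rewrite e ry; lia.
have blk v : v \in atoms_in \bot y ->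
    [/\ #|block y v| = 2, block y v \subset atoms_in \bot y, v \in block y v &
      {in block y v, forall u, block y u = block y v}].
  move=> vA; have [z [vz zy rz]] := above v vA.
  move: vA; rewrite mem_atoms => /andP[/eqP rv vy].
  have bz := block_butterfly A2 K3 ry rv vz zy.
  rewrite bz ?rz //; split.
  - by rewrite card_atoms ?le0x // rank_bot // rz A2 //; lia.
  - by apply/subsetP=> a; rewrite !mem_atoms => /andP[-> /le_trans->] //; apply: ltW.
  - by rewrite mem_atoms rv.
  - move=> u; rewrite mem_atoms => /andP[/eqP ru uz].
    by rewrite (block_butterfly A2 K3 ry ru uz zy) ?rz.
have [|v vA] := @card_gt0P _ (mem (atoms_in \bot y)) _; first by rewrite cy.
have [cv sv vv ev] := blk v vA.
have : block y v \proper atoms_in \bot y by rewrite properEcard sv cv cy.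
case/properP=> _ [w wA wv]; have [cw sw ww ew] := blk w wA.
have dis : block y v :&: block y w = set0.
  apply/setP=> u; rewrite in_setI in_set0.
  by apply/negP=> /andP[/ev uv /ew uw]; case/negP: wv; rewrite -uv uw.
have : (#|block y v :|: block y w| <= 3)%N.
  by rewrite -cy; apply: subset_leq_card; rewrite subUset sv.
by rewrite cardsU dis cards0 cv cw.
Qed.

Hypothesis eulP : eulerian P.

Lemma euler_levels y : \bot < y ->
  (\sum_(j < (rank y).+1) (-1) ^+ j * #|level \bot y j|%:Z = 0 :> int)%R.
Proof.
move=> y0.
have sgn i : ((-1) ^+ i = (if odd i then -1 else 1) :> int)%R.
  by rewrite -GRing.signr_odd; case: odd.
transitivity (\sum_(z in interval \bot y) (-1) ^+ (rank z) : int)%R.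
  (* Ranks in [[\bot, y]] are at most [rank y], so [inord] does not alter them. *)
  rewrite (partition_big (fun z : P => inord (rank z) : 'I_(rank y).+1) xpredT) //=.
  apply: eq_bigr => j _.
  rewrite (eq_bigr (fun=> (-1) ^+ j)%R) => [|z /andP[zy /eqP<-]]; last first.
    by rewrite inordK // ltnS (le_rank binP) //; move: zy; rewrite inE => /andP[].
  rewrite GRing.sumr_const -GRing.mulr_natr natz; congr (_ * Posz _)%R.
  apply: eq_card => z; rewrite levelE [in RHS]unfold_in /= !inE rank_bot // add0n andbA.
  apply: andb_id2l => /andP[_ zy]; rewrite -val_eqE /= inordK //.
  by rewrite ltnS (le_rank binP).
have cst (Q : pred P) (c : int) : (\sum_(z in interval \bot y | Q z) c =
    c * #|[set z in interval \bot y | Q z]|%:Z)%R.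
  rewrite GRing.sumr_const -GRing.mulr_natr natz; congr (_ * Posz _)%R.
  by apply: eq_card => z; rewrite [RHS]in_set.
rewrite (bigID (fun z => odd (rank z))) /=.
rewrite (eq_bigr (fun=> -1)%R) => [|z /andP[_ oz]]; last by rewrite sgn oz.
rewrite GRing.addrC (eq_bigr (fun=> 1)%R) => [|z /andP[_ oz]]; last first.
  by rewrite sgn (negbTE oz).
by rewrite !cst (eulP.2 _ _ y0); ring.
Qed.

End AtomNumbers.

(** * The two possible atom functions *)

Section Dichotomy.
Context {d : Order.disp_t} {P : finTBPOrderType d}.
Implicit Types (x y z t u v w : P).
Hypotheses (binP : binomial_poset P) (eulP : eulerian P).
Local Notation A := (@atom_number _ P).
Local Notation n := (rank (\top%O : P)).

Lemma exists_rank_bot k : k <= n -> exists y : P, rank y = k.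
Proof.
move=> kn; have [|y [_ _ <-]] := @exists_rank _ _ binP \bot%O \top%O k (le0x _).
  by rewrite rank_bot.
by exists y.
Qed.

Lemma bot_lt y : 0 < rank y -> (\bot < y)%O.
Proof.
by move=> ry; rewrite lt0x; apply: contraTneq ry => ->; rewrite rank_bot.
Qed.

Lemma level_bot_mul y j : j < rank y ->
  #|level \bot%O y j| * A (rank y - j) = #|level \bot%O y j.+1| * A j.+1.
Proof. by move=> jy; apply: level_mul; rewrite ?le0x // rank_bot // subn0. Qed.

Lemma card_level_bot0 y : #|level \bot%O y 0| = 1.
Proof. by rewrite level0 ?cards1 ?le0x. Qed.

Lemma card_level_bot1 y : #|level \bot%O y 1| = A (rank y).
Proof. by rewrite level1 // card_atoms ?le0x // rank_bot // subn0. Qed.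

Lemma card_level_bot_rank y : #|level \bot%O y (rank y)| = 1.
Proof.
have := @level_top _ _ binP _ _ (le0x y); rewrite rank_bot // subn0 => ->.
exact: cards1.
Qed.

(** The Euler relation in length 2 reads 1 - A(2) + 1 = 0. *)
Lemma atom_number2 : 2 <= n -> A 2 = 2.
Proof.
move=> n2; have [y ry] := exists_rank_bot n2; have ry0 : 0 < rank y by rewrite ry.
have eul := euler_levels binP eulP (bot_lt ry0); rewrite ry in eul.
have c2 := card_level_bot_rank y; rewrite ry in c2.
have c1 := card_level_bot1 y; rewrite ry in c1.
move: eul; rewrite !big_ord_recl big_ord0 /= card_level_bot0 /bump /= c1 c2; lia.
Qed.

Lemma card_level_bot_coatoms y : 0 < rank y ->
  #|level \bot%O y (rank y).-1| = A (rank y).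
Proof.
move=> ry; have := @level_bot_mul y (rank y).-1; rewrite ltn_predL ry => /(_ isT).
rewrite (prednK ry) card_level_bot_rank mul1n => <-.
rewrite (_ : rank y - _ = 1); last lia.
rewrite atom_number1 ?muln1 //.
by apply: leq_trans ry _; apply: le_rank => //; apply: lex1.
Qed.

Lemma atom_number_butterfly K : ~~ odd K -> K.+4 <= n ->
    (forall k, 2 <= k <= K.+2 -> A k = 2) ->
  4 + A K.+3 * A K.+4 = 4 * A K.+4.
Proof.
move=> evK Kn A2; have [y ry] := exists_rank_bot Kn.
have ry0 : 0 < rank y by rewrite ry.
have mul := @level_bot_mul y; rewrite ry in mul.
have cb := card_level_bot_coatoms ry0; rewrite ry /= in cb.
have ct := card_level_bot_rank y; rewrite ry in ct.
have c1 := card_level_bot1 y; rewrite ry in c1.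
have eul := euler_levels binP eulP (bot_lt ry0); rewrite ry in eul.
apply: (@euler_constant (fun j => #|level \bot%O y j|) K _ _ evK
  (card_level_bot0 y) c1 _ cb ct eul) => [|i] /=.
  have := mul 1 isT; rewrite c1 subn1 /= => ->; by rewrite (@A2 2).
elim: i => // i IH iK; rewrite -IH; last lia.
have lti : i.+2 < K.+4 by lia.
have := mul _ lti; rewrite (@A2 (K.+4 - i.+2)); last lia.
rewrite (@A2 i.+3); last lia.
by move/eqP; rewrite eqn_pmul2r // => /eqP.
Qed.

Lemma atom_number_boolean K : ~~ odd K -> K.+4 <= n ->
    (forall k, 0 < k <= K.+2 -> A k = k) ->
  K.+4 + A K.+3 * A K.+4 = K.+4 * A K.+4.
Proof.
move=> evK Kn Ak; have [y ry] := exists_rank_bot Kn.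
have ry0 : 0 < rank y by rewrite ry.
have mul := @level_bot_mul y; rewrite ry in mul.
have cb := card_level_bot_coatoms ry0; rewrite ry /= in cb.
have ct := card_level_bot_rank y; rewrite ry in ct.
have c1 := card_level_bot1 y; rewrite ry in c1.
have eul := euler_levels binP eulP (bot_lt ry0); rewrite ry in eul.
move: mul cb ct c1 eul; set W := fun j => #|level \bot%O y j|.
set N := K.+4 => mul cb ct c1 eul.
apply: (@euler_binomial W K _ _ evK (card_level_bot0 y) c1 _ cb ct eul (fun j => 'C(N, j))).
- by have := mul 1 isT; rewrite -/(W 1) -/(W 2) /W c1 subn1 /= (Ak 2).
- by rewrite bin0.
- by rewrite bin1.
- by rewrite -bin_sub // subSnn bin1.
- by rewrite binn.
- rewrite bin2 muln2 halfK (_ : odd _ = false) ?subn0 // oddM /N /=.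
  by case: (odd K).
- exact: alternating_sum_binomial.
(* Level sizes and binomial coefficients obey the same recursion: (N - j) times the term at j is j +
   1 times the term at j + 1. *)
elim=> // i IH iK.
have e1 := IH (ltnW iK).
have lti : i.+2 < N by rewrite /N; lia.
have := mul _ lti; rewrite Ak; last by rewrite /N; lia.
rewrite Ak; last lia.
have e2 := mul_bin_left N i.+2.
rewrite -/(W _) -/(W _) => e3.
apply/eqP; rewrite -(eqn_pmul2l (ltn0Sn i.+2)); apply/eqP.
rewrite [RHS]mulnCA e2 [RHS]mulnCA -e1 [LHS]mulnA [i.+3 * _]mulnC -e3.
by rewrite mulnAC mulnC.
Qed.

Lemma atom_number_dichotomy m : 2 <= m -> m.*2 <= n ->
  (forall k, 0 < k <= m.*2 -> A k = k) \/ (forall k, 2 <= k <= m.*2 -> A k = 2).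
Proof.
elim: m => // m IH m_gt0 mn.
have n2 : 2 <= n by apply: leq_trans mn; rewrite doubleS.
have A2 := atom_number2 n2.
have A1 := @atom_number1 _ _ binP (ltnW n2).
have mono k := @atom_number_leS _ _ binP k.
have [m1|m2] := leqP m 1.
  have {m1 IH}m1 : m = 1 by lia.
  have n4 : 4 <= n by rewrite m1 in mn.
  have e : 4 + A 3 * A 4 = 4 * A 4.
    (* With [K = 0] the only value assumed is [A 2 = 2], so this relation holds before the two cases
       separate. *)
    by apply: atom_number_butterfly => // k k2; have -> : k = 2 by lia.
  have le23 : A 2 <= A 3 by apply: mono; lia.
  have [a2|a3] : A 3 = 2 \/ A 3 = 3 by nia.
    right=> k; rewrite m1 => kb.
    have [->|[->|->]] : k = 2 \/ (k = 3 \/ k = 4) by lia.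
    - by [].
    - by [].
    by rewrite a2 in e; lia.
  left=> k; rewrite m1 => kb.
  have [->|[->|[->|->]]] : k = 1 \/ (k = 2 \/ (k = 3 \/ k = 4)) by lia.
  - by [].
  - by [].
  - by [].
  by rewrite a3 in e; lia.
have [K [evK mK]] : exists K, ~~ odd K /\ m.*2 = K.+2.
  by exists m.-1.*2; rewrite odd_double; split=> //; lia.
have K2 : 2 <= K by lia.
have Kn : K.+4 <= n by move: mn; rewrite doubleS mK.
have le1 : A K.+2 <= A K.+3 by apply: mono; lia.
have le2 : A K.+3 <= A K.+4 by apply: mono; lia.
rewrite doubleS mK; rewrite mK in IH.
case: (IH m2 (ltnW (ltnW Kn))) => Ak; [left|right].
  have e := atom_number_boolean evK Kn Ak.
  have AK := Ak K.+2 (leqnn _).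
  (* If [A K.+3] were at least [K.+4], the left side of [e] would exceed the right side. *)
  have ltN : A K.+3 < K.+4.
    by rewrite ltnNge; apply/negP=> le; have := leq_mul le (leqnn (A K.+4)); lia.
  have [a|a] : A K.+3 = K.+2 \/ A K.+3 = K.+3 by lia.
    (* Here [e] says that twice [A K.+4] is [K.+4], against [A K.+4 >= K.+2] and [K >= 2]. *)
    by move: e; rewrite a; lia.
  have b : A K.+4 = K.+4 by move: e; rewrite a; lia.
  move=> k kb; have [|[->|->]] : k <= K.+2 \/ (k = K.+3 \/ k = K.+4) by lia.
  - by move=> kK; apply: Ak; lia.
  - by [].
  - by [].
have e := atom_number_butterfly evK Kn Ak.
have AK := Ak K.+2 (leqnn _).
have a3 : A K.+3 <> 3 by apply: (atom_number_neq3 binP Ak); lia.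
have lt4 : A K.+3 < 4.
  by rewrite ltnNge; apply/negP=> le; have := leq_mul le (leqnn (A K.+4)); lia.
have a : A K.+3 = 2 by lia.
have b : A K.+4 = 2 by move: e; rewrite a; lia.
move=> k kb; have [|[->|->]] : k <= K.+2 \/ (k = K.+3 \/ k = K.+4) by lia.
- by move=> kK; apply: Ak; lia.
- by [].
- by [].
Qed.

End Dichotomy.

(** * Recognizing k-summations *)

Section KSumCriterion.
Context {d d' : Order.disp_t} {P : finTBPOrderType d} {Q : finTBPOrderType d'}.
Implicit Types (x y z u v : P).
Local Open Scope order_scope.
(** [h] records the position of an element inside its copy of [Q], while the class of the atoms
    below it tells which copy. Hence [h] has to reflect the order only within one class ([h_le]),
    and each class has to realize every inner element of [Q] ([h_surj]). *)
Variable h : P -> Q.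
Local Notation B := (block (\top : P)).
Hypotheses (P01 : \bot < \top :> P)
  (h0 : forall x, (h x == \bot) = (x == \bot))
  (h1 : forall x, (h x == \top) = (x == \top))
  (block_eq : forall u v, covers \bot v -> u \in B v -> B u = B v)
  (h_le : forall u v x y, x < \top -> y < \top -> u \in atoms_in \bot x ->
     v \in atoms_in \bot y -> v \in B u -> (x <= y) = (h x <= h y))
  (h_surj : forall v q, covers \bot v -> q != \bot -> q != \top ->
     exists u x, [/\ x < \top, u \in atoms_in \bot x, u \in B v & h x = q]).

Lemma block_refl v : covers \bot v -> v < \top -> v \in B v.
Proof. by move=> cv v1; apply/blockP; split=> //; exists v. Qed.

Definition blocks : {set {set P}} := [set B v | v in [set v | covers \bot v]].

(** For [x] other than [\bot] and [\top] all sets in this union coincide, as [x] bounds its atoms;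
    the union avoids choosing an atom. *)
Definition block_of x : {set P} := \bigcup_(u in atoms_in \bot x) B u.

Lemma block_ofE u x : x < \top -> u \in atoms_in \bot x -> block_of x = B u.
Proof.
move=> x1 ux; apply/setP=> w; apply/bigcupP/idP=> [[v vx wv]|wu]; last by exists u.
have [cu ux'] : covers \bot u /\ u <= x by apply/andP; rewrite inE in ux.
have [cv vx'] : covers \bot v /\ v <= x by apply/andP; rewrite inE in vx.
rewrite -(block_eq (u := v) cu) //; apply/blockP; split=> //.
by exists x.
Qed.

Lemma exists_atom_bot x : x != \bot -> exists u, u \in atoms_in \bot x.
Proof.
by rewrite -lt0x => /exists_atom[u cu ux]; exists u; rewrite inE cu.
Qed.

Lemma ksum_isomorphic : exists k, (0 < k)%N /\ order_isomorphic P (ksum k Q).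
Proof.
have [v0 v0P] : exists u : P, u \in atoms_in \bot \top.
  by apply: exists_atom_bot; rewrite gt_eqF.
have B0 : B v0 \in blocks.
  by apply: imset_f; move: v0P; rewrite !inE => /andP[].
have k_gt0 : (0 < #|blocks|)%N by apply/card_gt0P; exists (B v0).
pose ext x := (x == \bot) || (x == \top).
(* The shared [\bot] and [\top] of the sum live in copy 0. *)
pose idx x := if ext x then Ordinal k_gt0 else enum_rank_in B0 (block_of x).
have fP x : ((idx x, h x).2 \in [:: \bot; \top]) ==> ((idx x, h x).1 == 0 :> nat).
  by rewrite /= !inE h0 h1 /idx /ext; case: (_ || _).
pose f x : ksum #|blocks| Q := KSum (fP x).
have blk x : x != \bot -> x != \top -> exists u,
    [/\ u \in atoms_in \bot x, x < \top, covers \bot u, block_of x = B u & u \in B u].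
  move=> x0; rewrite -ltx1 => x1; have [u ux] := exists_atom_bot x0; exists u.
  have [cu ux'] : covers \bot u /\ u <= x by apply/andP; rewrite inE in ux.
  by rewrite (block_ofE x1 ux) block_refl ?(le_lt_trans ux').
have fle : {mono f : x y / x <= y}.
  move=> x y; rewrite {1}/Order.le /= /ksum_le /= h0 h1.
  have [->|x0] := eqVneq x \bot; first by rewrite le0x.
  have [->|y1] := eqVneq y \top; first by rewrite lex1.
  have [->|x1] := eqVneq x \top.
    rewrite le1x (negbTE y1) /=; apply/negP=> /andP[_].
    have /eqP-> : h \top == \top by rewrite h1.
    by rewrite le1x h1 (negbTE y1).
  have [->|y0] := eqVneq y \bot.
    rewrite lex0 (negbTE x0) /=; apply/negP=> /andP[_].
    have /eqP-> : h \bot == \bot by rewrite h0.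
    by rewrite lex0 h0 (negbTE x0).
  have [u [ux x1' cu Bu uu]] := blk x x0 x1.
  have [v [vy y1' cv Bv vv]] := blk y y0 y1.
  rewrite /= /idx /ext (negbTE x0) (negbTE x1) (negbTE y0) (negbTE y1) /=.
  have inj : (enum_rank_in B0 (block_of x) == enum_rank_in B0 (block_of y)) = (B u == B v).
    rewrite Bu Bv; apply/eqP/eqP=> [|->//] /(congr1 enum_val).
    by rewrite !enum_rankK_in //; apply: imset_f; rewrite inE.
  rewrite inj; have [eB|nB] := eqVneq (B u) (B v).
    by rewrite /= (@h_le u v) // eB.
  (* An atom of [x] would also be an atom of [y], forcing the two classes to agree. *)
  apply/esym/negP=> xy; case/eqP: nB; rewrite -Bv; apply/esym/block_ofE => //.
  by move: ux; rewrite !inE => /andP[-> ux']; rewrite (le_trans ux').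
exists #|blocks|; split=> //; exists f => //.
have fI : injective f.
  by move=> x y e; apply: le_anti; rewrite -!fle e lexx.
have fS p : exists x, f x == p.
  case: p => -[i q] pP; have := pP; rewrite /= !inE.
  have [q0|q0] := eqVneq q \bot; first move=> /= i0.
    exists \bot; apply/eqP/val_inj; congr (_, _) => /=.
      by apply: val_inj; rewrite /idx /ext eqxx /= (eqP i0).
    by rewrite q0; apply/eqP; rewrite h0.
  have [q1|q1] := eqVneq q \top; first move=> /= i0.
    exists \top; apply/eqP/val_inj; congr (_, _) => /=.
      by apply: val_inj; rewrite /idx /ext eqxx orbT /= (eqP i0).
    by rewrite q1; apply/eqP; rewrite h1.
  move=> _; have /imsetP[v] := enum_valP i; rewrite inE => cv vE.
  have [u [x [x1 ux uv hx]]] := h_surj cv q0 q1.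
  exists x; apply/eqP/val_inj; congr (_, _) => //=.
  rewrite /idx /ext -h0 -h1 hx (negbTE q0) (negbTE q1) /=.
  by rewrite (block_ofE x1 ux) (block_eq cv uv) -vE enum_valK_in.
pose g p := xchoose (fS p); have gK : cancel g f by move=> p; apply/eqP/(xchooseP (fS p)).
by exists g => // x; apply: fI; rewrite gK.
Qed.

End KSumCriterion.

(** * Boolean intervals *)

Section BooleanIntervals.
Context {d : Order.disp_t} {P : finTBPOrderType d}.
Implicit Types (x y z t u v w a c e : P) (S : {set P}).
Local Open Scope order_scope.
Hypothesis binP : binomial_poset P.
Local Notation A := (@atom_number _ P).
Variable K : nat.
Hypothesis Aid : forall k, (0 < k <= K)%N -> A k = k.

Lemma card_atoms_boolean x y : x <= y -> (rank y - rank x <= K)%N ->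
  #|atoms_in x y| = (rank y - rank x)%N.
Proof.
move=> xy lenK; have [r0|r_gt0] := posnP (rank y - rank x).
  have -> : x = y by apply: (le_rank_eq binP) => //; lia.
  by rewrite atoms_inxx cards0 subnn.
by rewrite card_atoms // Aid // r_gt0.
Qed.

Lemma card_coatoms_boolean x y : x <= y -> (rank y - rank x <= K)%N ->
  #|coatoms_in x y| = (rank y - rank x)%N.
Proof. by move=> xy lenK; rewrite eq_card_coatoms // card_atoms_boolean. Qed.

Lemma coatoms_subset x z y : x <= z -> coatoms_in z y \subset coatoms_in x y.
Proof.
by move=> xz; apply/subsetP=> c; rewrite !inE => /andP[/(le_trans xz)->].
Qed.

Lemma atoms_subset x z y : z <= y -> atoms_in x z \subset atoms_in x y.
Proof.
by move=> zy; apply/subsetP=> c; rewrite !inE => /andP[-> /le_trans->].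
Qed.

(** If [[x, y]] has length r, it has r coatoms, of which r - 1 lie above the atom [a], because
    [[a, y]] has length r - 1. So just one omits [a]. *)
Lemma eq_coatom_omitting x y a c c' : (rank y - rank x <= K)%N ->
    a \in atoms_in x y -> c \in coatoms_in x y -> c' \in coatoms_in x y ->
  ~~ (a <= c) -> ~~ (a <= c') -> c = c'.
Proof.
move=> lenK; rewrite atoms_inE // => /and3P[xa ay /eqP ra] cP c'P ac ac'.
have xy := le_trans xa ay.
have /eqP/cards1P[t tE] : #|coatoms_in x y :\: coatoms_in a y| = 1%N.
  rewrite cardsD (setIidPr (coatoms_subset y xa)) !card_coatoms_boolean //; last lia.
  by have := le_rank binP ay; lia.
have in1 s : s \in coatoms_in x y -> ~~ (a <= s) -> s = t.
  by move=> sP as'; apply/set1P; rewrite -tE inE sP andbT inE (negbTE as').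
by rewrite (in1 c) // (in1 c').
Qed.

Lemma card_omitted x y c : (rank y - rank x <= K)%N -> c \in coatoms_in x y ->
  #|atoms_in x y :\: atoms_in x c| = 1%N.
Proof.
move=> lenK; rewrite coatoms_inE // => /and3P[xc cy /eqP rc].
rewrite cardsD (setIidPr (atoms_subset x cy)) !card_atoms_boolean //; try lia.
  by have := le_rank binP xc; lia.
exact: le_trans xc cy.
Qed.

(* Sending a coatom above z to the one atom it misses is injective, and there
   are as many coatoms above z as atoms not below z. *)
Lemma exists_coatom_omitting x z y a : (rank y - rank x <= K)%N -> x <= z -> z <= y ->
    a \in atoms_in x y -> ~~ (a <= z) ->
  exists2 c, c \in coatoms_in z y & ~~ (a <= c).
Proof.
move=> lenK xz zy aP az; have xy := le_trans xz zy.
have rxz := le_rank binP xz; have rzy := le_rank binP zy.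
(* For a coatom [c] the set is a singleton by [card_omitted], so the default [x] is never taken. *)
pose om c := odflt x [pick b in atoms_in x y :\: atoms_in x c].
have omP c : c \in coatoms_in x y -> om c \in atoms_in x y :\: atoms_in x c.
  move=> cP; rewrite /om; case: pickP => //= none.
  have := card_omitted lenK cP; rewrite (eq_card0 none); lia.
have omN c : c \in coatoms_in x y -> om c \in atoms_in x y /\ ~~ (om c <= c).
  move=> /omP/setDP[ap]; rewrite !inE; move: ap; rewrite !inE => /andP[-> ->].
  by split.
have omI : {in coatoms_in z y &, injective om}.
  move=> c c' /(subsetP (coatoms_subset y xz)) cP /(subsetP (coatoms_subset y xz)) c'P e.
  have [o1 o2] := omN c cP; have [o1' o2'] := omN c' c'P.
  by apply: (eq_coatom_omitting lenK o1) => //; rewrite e.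
have omE : om @: coatoms_in z y = atoms_in x y :\: atoms_in x z.
  apply/eqP; rewrite eqEcard; apply/andP; split.
    apply/subsetP=> _ /imsetP[c cP ->].
    have [o1 o2] := omN c (subsetP (coatoms_subset y xz) c cP).
    rewrite inE o1 andbT inE negb_and; apply/orP; right; apply: contra o2.
    by move=> /le_trans; apply; move: cP; rewrite inE => /andP[].
  rewrite card_in_imset // cardsD (setIidPr (atoms_subset x zy)).
  by rewrite !card_atoms_boolean ?card_coatoms_boolean //; lia.
have : a \in atoms_in x y :\: atoms_in x z by rewrite inE aP andbT inE (negbTE az) andbF.
rewrite -omE => /imsetP[c cP ->]; exists c => //.
by have [] := omN c (subsetP (coatoms_subset y xz) c cP).
Qed.

(** Induction on the rank of [y]. If [z'] is not [y], some atom misses [z'], hence also [z]; both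
    then lie below the unique coatom omitting that atom, which replaces [y]. *)
Lemma le_boolean x y z z' : (rank y - rank x <= K)%N ->
    x <= z -> z <= y -> x <= z' -> z' <= y ->
  atoms_in x z \subset atoms_in x z' -> z <= z'.
Proof.
move=> + xz + xz' + sub.
elim/ltn_ind: (rank y) {-2}y (erefl (rank y)) => r IH {}y ry lenK zy z'y.
subst r.
have [->//|z'y'] := eqVneq z' y.
have ltz' : (rank z' < rank y)%N by apply: (lt_rank binP); rewrite lt_neqAle z'y'.
have rz' := le_rank binP xz'.
have xy := le_trans xz zy.
have : atoms_in x z' \proper atoms_in x y.
  rewrite properEcard atoms_subset // !card_atoms_boolean //; lia.
case/properP=> _ [a aP az'].
have {}az' : ~~ (a <= z') by apply: contra az'; move: aP; rewrite !inE => /andP[->].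
have az : ~~ (a <= z).
  apply: contra az' => az; have := subsetP sub a; rewrite !inE az.
  by move: aP; rewrite inE => /andP[-> _] /(_ isT).
have [c cP ac] := exists_coatom_omitting lenK xz' z'y aP az'.
have [c' c'P ac'] := exists_coatom_omitting lenK xz zy aP az.
have e : c = c'.
  apply: (eq_coatom_omitting lenK aP) ac ac'.
    exact: (subsetP (coatoms_subset y xz')).
  exact: (subsetP (coatoms_subset y xz)).
subst c'; move: cP c'P; rewrite !coatoms_inE // => /and3P[z'c cy /eqP rc] /and3P[zc _ _].
have lenc : (rank c - rank x <= K)%N.
  by apply: leq_trans lenK; rewrite rc leq_sub2r.
by apply: (IH (rank c) _ c) => //; rewrite rc.
Qed.

(** Descend from [y]: the coatom omitting an atom [a] outside [S] loses exactly [a] from the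
    atoms. *)
Lemma exists_atoms_eq x y S : x <= y -> (rank y - rank x <= K)%N ->
    S \subset atoms_in x y ->
  exists z, [/\ x <= z, z <= y & atoms_in x z = S].
Proof.
elim/ltn_ind: (rank y) {-2}y (erefl (rank y)) => r IH {}y ry xy lenK SP.
subst r; have [->|nS] := eqVneq S (atoms_in x y); first by exists y.
have /properP[_ [a aP aS]] : S \proper atoms_in x y by rewrite properEneq nS.
have ax : ~~ (a <= x).
  by move: aP; rewrite inE => /andP[/covers_lt xa _]; rewrite lt_geF.
have [c cP ac] := exists_coatom_omitting lenK (lexx x) xy aP ax.
have cE : atoms_in x c = atoms_in x y :\ a.
  apply/eqP; rewrite eqEcard; apply/andP; split.
    apply/subsetP=> b bP; rewrite in_setD1; apply/andP; split.
      by apply: contraNneq ac => <-; move: bP; rewrite inE => /andP[].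
    move: cP; rewrite inE => /andP[_ /covers_lt/ltW cy].
    exact: (subsetP (atoms_subset x cy)).
  have := cardsD1 a (atoms_in x y); rewrite aP => e1.
  move: (card_omitted lenK cP); rewrite cardsD.
  move: cP; rewrite coatoms_inE // => /and3P[_ cy _].
  rewrite (setIidPr (atoms_subset x cy)) e1.
  by move: #|_| #|_| => p q; lia.
move: (cP); rewrite coatoms_inE // => /and3P[xc cy /eqP rc].
have [|||z [xz zc zE]] := IH (rank c) _ c (erefl _) xc.
- by rewrite rc.
- by apply: leq_trans lenK; rewrite rc leq_sub2r.
- by rewrite cE subsetD1 SP aS.
by exists z; rewrite (le_trans zc cy).
Qed.

End BooleanIntervals.

(** * Sums of boolean lattices *)

Section BooleanSum.
Context {d : Order.disp_t} {P : finTBPOrderType d}.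
Implicit Types (x y z t u v w a c e : P) (S : {set P}).
Local Open Scope order_scope.
Variable K : nat.
Hypotheses (binP : binomial_poset P) (rank_top : rank (\top : P) = K.+1)
  (K3 : (3 <= K)%N)
  (Aid : forall k, (0 < k <= K)%N -> @atom_number _ P k = k).
Local Notation B := (block (\top : P)).

Lemma lt_top x : (x < \top) = (rank x <= K)%N.
Proof.
apply/idP/idP=> [/(lt_rank binP)|rx]; first by rewrite rank_top.
by rewrite ltx1; apply: contraTneq rx => ->; rewrite rank_top ltnn.
Qed.

Lemma card_atoms_bot x : x < \top -> #|atoms_in \bot x| = rank x.
Proof.
rewrite lt_top => rx; have len : (rank x - rank (\bot : P) <= K)%N.
  by rewrite rank_bot // subn0.
by rewrite (card_atoms_boolean binP Aid (le0x x) len) rank_bot // subn0.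
Qed.

Lemma le_bot_boolean y z z' : y < \top -> z <= y -> z' <= y ->
  atoms_in \bot z \subset atoms_in \bot z' -> z <= z'.
Proof.
rewrite lt_top => ry zy z'y; apply: (le_boolean binP Aid (y := y)) => //.
all: by rewrite ?le0x ?rank_bot ?subn0.
Qed.

(** An element of rank 2 below the top has two atoms and is treated as an edge joining them. *)
Lemma exists_edge u v z : rank u = 1%N -> rank v = 1%N -> u != v ->
    u <= z -> v <= z -> z < \top ->
  exists e, [/\ rank e = 2, u <= e, v <= e & e <= z].
Proof.
move=> ru rv uv uz vz z1.
have len : (rank z - rank (\bot : P) <= K)%N by rewrite rank_bot // subn0 -lt_top.
have [|e [_ ez eE]] := @exists_atoms_eq _ _ binP _ Aid \bot z [set u; v] (le0x z) len.
  by apply/subsetP=> w /set2P[] ->; rewrite mem_atoms // ?ru ?rv ?uz ?vz.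
have := card_atoms_bot (le_lt_trans ez z1); rewrite eE cards2 uv => re.
have : u \in atoms_in \bot e by rewrite eE set21.
have : v \in atoms_in \bot e by rewrite eE set22.
by rewrite !mem_atoms // => /andP[_ ve] /andP[_ ue]; exists e.
Qed.

Lemma len_atom v : rank v = 1%N -> (rank (\top : P) - rank v <= K)%N.
Proof. by move=> ->; rewrite rank_top subn1. Qed.

Lemma mem_edges v e : rank v = 1%N ->
  (e \in atoms_in v \top) = (v <= e) && (rank e == 2).
Proof. by move=> rv; rewrite atoms_inE // lex1 rv. Qed.

(** In [[v, \top]] the edges at [v] are atoms, so some [z] has exactly [e] and [e'] as atoms over
    [v]. Its rank is at most 3, which is below the top since [K >= 3]. *)
Lemma edges_bounded v e e' : rank v = 1%N ->
    e \in atoms_in v \top -> e' \in atoms_in v \top ->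
  exists z, [/\ e <= z, e' <= z & z < \top].
Proof.
move=> rv eP e'P.
have [|z [vz _ zE]] :=
  @exists_atoms_eq _ _ binP _ Aid v \top [set e; e'] (lex1 v) (len_atom rv).
  by apply/subsetP=> w /set2P[] ->.
have ez : e \in atoms_in v z by rewrite zE set21.
have e'z : e' \in atoms_in v z by rewrite zE set22.
exists z; move: ez e'z; rewrite !inE => /andP[_ ->] /andP[_ ->]; split=> //.
rewrite lt_top leqNgt; apply/negP=> ltK.
have lez := le_rank binP (lex1 z).
have := card_atoms_boolean binP Aid vz; rewrite rv zE cards2 rank_top in lez *.
by case: (e != e') => /(_ _); lia.
Qed.

(** [edges_bounded] puts both edges into one interval [[\bot, z]] with [z] below the top, where
    elements are determined by their atoms. *)
Lemma edge_inj u v e e' : rank u = 1%N -> rank v = 1%N -> u != v ->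
    rank e = 2 -> rank e' = 2 -> u <= e -> v <= e -> u <= e' -> v <= e' ->
  e = e'.
Proof.
move=> ru rv uv re re' ue ve ue' ve'.
have [||z [ez e'z z1]] := @edges_bounded v e e' rv.
- by rewrite mem_edges // ve re.
- by rewrite mem_edges // ve' re'.
have atE f : rank f = 2 -> u <= f -> v <= f -> atoms_in \bot f = [set u; v].
  move=> rf uf vf; apply/esym/eqP; rewrite eqEcard cards2 uv.
  rewrite card_atoms_bot ?lt_top ?rf ?(ltnW K3) // andbT.
  by apply/subsetP=> w /set2P[] ->; rewrite mem_atoms // ?ru ?rv ?uf ?vf.
by apply: le_anti; apply/andP; split; apply: (le_bot_boolean z1) => //; rewrite !atE.
Qed.

(* For e of rank 2 above the atom v, the second atom of e. *)
Definition other v e : P := odflt v [pick u in atoms_in \bot e :\ v].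

Lemma otherP v e : rank v = 1%N -> e \in atoms_in v \top ->
  [/\ rank (other v e) = 1%N, other v e != v, other v e <= e &
      forall u, rank u = 1%N -> u <= e -> u != v -> u = other v e].
Proof.
move=> rv; rewrite mem_edges // => /andP[ve /eqP re].
have vP : v \in atoms_in \bot e by rewrite mem_atoms // rv ve.
have /eqP/cards1P[w wE] : #|atoms_in \bot e :\ v| = 1%N.
  have := cardsD1 v (atoms_in \bot e).
  by rewrite vP card_atoms_bot ?lt_top ?re ?(ltnW K3) // => -[].
have -> : other v e = w.
  rewrite /other wE; case: pickP => [u /set1P//|/(_ w)]; by rewrite set11.
have : w \in atoms_in \bot e :\ v by rewrite wE set11.
rewrite in_setD1 mem_atoms // => /and3P[wv /eqP rw we]; split=> // u ru ue uv.
by apply/set1P; rewrite -wE in_setD1 uv mem_atoms // ru ue.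
Qed.

Lemma other_inj v : rank v = 1%N -> {in atoms_in v \top &, injective (other v)}.
Proof.
move=> rv e e' eP e'P o.
have [r1 n1 l1 _] := otherP rv eP; have [r2 n2 l2 _] := otherP rv e'P.
move: eP e'P; rewrite !mem_edges // => /andP[ve /eqP re] /andP[ve' /eqP re'].
by apply: (edge_inj r1 rv) => //; rewrite o.
Qed.

Lemma mem_block v u :
  reflect (rank u = 1%N /\ exists z, [/\ u <= z, v <= z & z < \top]) (u \in B v).
Proof.
apply: (iffP (blockP _ _ _)) => -[ru H]; split=> //.
  by apply/eqP; rewrite -atom_rank.
by rewrite atom_rank // ru.
Qed.

Lemma blockxx v : rank v = 1%N -> v \in B v.
Proof.
by move=> rv; apply/mem_block; split=> //; exists v; rewrite lt_top rv (ltnW (ltnW K3)).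
Qed.

Lemma block_other v u : rank v = 1%N -> u \in B v -> u != v ->
  exists2 e, e \in atoms_in v \top & u = other v e.
Proof.
move=> rv /mem_block[ru [z [uz vz z1]]] uv.
have [e [re ue ve ez]] := exists_edge ru rv uv uz vz z1.
have eP : e \in atoms_in v \top by rewrite mem_edges // ve re.
by exists e => //; have [_ _ _] := otherP rv eP; apply.
Qed.

Lemma blockE v : rank v = 1%N -> B v = v |: other v @: atoms_in v \top.
Proof.
move=> rv; apply/setP=> u; rewrite in_setU1.
have [->|uv] := eqVneq u v; first by rewrite blockxx.
apply/idP/imsetP=> [/block_other[]// e eP ->|[e eP ->]]; first by exists e.
have [r1 n1 l1 _] := otherP rv eP.
move: eP; rewrite mem_edges // => /andP[ve /eqP re].
apply/mem_block; split=> //; exists e; split=> //.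
by rewrite lt_top re (ltnW K3).
Qed.

(** Besides [v], the class contains one atom for each of the [K] edges at [v]. *)
Lemma card_block v : rank v = 1%N -> #|B v| = K.+1.
Proof.
move=> rv; rewrite blockE // cardsU1 card_in_imset; last exact: other_inj.
rewrite (card_atoms_boolean binP Aid (lex1 v) (len_atom rv)) rv rank_top subn1 /=.
rewrite (_ : v \notin _) //; apply/imsetP=> -[e eP ev].
by have [_ + _ _] := otherP rv eP; rewrite -ev eqxx.
Qed.

Lemma block_sym u v : rank v = 1%N -> u \in B v -> v \in B u.
Proof.
by move=> rv /mem_block[ru [z [uz vz z1]]]; apply/mem_block; split=> //; exists z.
Qed.

(** Transitivity comes from [edges_bounded]: the edges joining [u] and [w] to [v] have a common
    upper bound below the top. Equal cardinalities give the other inclusion. *)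
Lemma boolean_block_eq u v : rank v = 1%N -> u \in B v -> B u = B v.
Proof.
move=> rv uv; have [ru _] := mem_block _ _ uv.
apply/esym/eqP; rewrite eqEcard !card_block // leqnn andbT; apply/subsetP=> w wv.
have [->|wv'] := eqVneq w v; first exact: block_sym.
have [->|uv'] := eqVneq u v; first by [].
have [rw _] := mem_block _ _ wv.
have [e eP ue] := block_other rv uv uv'; have [e' e'P we] := block_other rv wv wv'.
have [z [ez e'z z1]] := edges_bounded rv eP e'P.
have [_ _ l1 _] := otherP rv eP; have [_ _ l2 _] := otherP rv e'P.
apply/mem_block; split=> //; exists z; split=> //; first by rewrite we (le_trans l2).
by rewrite ue (le_trans l1).
Qed.

Lemma edge_le v e z : rank v = 1%N -> e \in atoms_in v \top -> v <= z -> z < \top ->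
  (e <= z) = (other v e <= z).
Proof.
move=> rv eP vz z1; have [r1 n1 l1 _] := otherP rv eP.
apply/idP/idP=> [|oz]; first exact: le_trans.
have [f [rf of' vf fz]] := exists_edge r1 rv n1 oz vz z1.
move: eP; rewrite mem_edges // => /andP[ve /eqP re].
by rewrite (edge_inj r1 rv n1 re rf).
Qed.

(** No common upper bound of [x] and [y] below the top is given, so they are compared inside
    [[v, \top]] for an atom [v] of [x]. Its atoms are the edges at [v], and [edge_le] translates
    them into atoms of P. *)
Lemma le_atoms x y : \bot < x -> x < \top -> y < \top ->
  (x <= y) = (atoms_in \bot x \subset atoms_in \bot y).
Proof.
move=> x0 x1 y1; apply/idP/idP=> [xy|sub]; first exact: atoms_subset.
have [v cv vx] := exists_atom x0.
have rv : rank v = 1%N by apply/eqP; rewrite -atom_rank.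
have leA w : rank w = 1%N -> w <= x -> w <= y.
  move=> rw wx; have := subsetP sub w; rewrite !mem_atoms // rw wx => /(_ isT).
  by case/andP.
apply: (le_boolean binP Aid (len_atom rv)) => //; rewrite ?lex1 ?leA //.
apply/subsetP=> e ex; have eP : e \in atoms_in v \top.
  by apply: subsetP ex; apply: atoms_subset; apply: lex1.
have [r1 _ _ _] := otherP rv eP.
move: ex; rewrite !inE => /andP[-> ex]; rewrite (edge_le rv) ?leA //.
by rewrite -(edge_le rv).
Qed.

(** Realize in [[v, \top]] the set of edges leading from [v] into [S]; an atom [w] of the class
    outside [S] keeps the result below the top. *)
Lemma exists_atoms_bot v S : rank v = 1%N -> v \in S -> S \proper B v ->
  exists2 x, x < \top & atoms_in \bot x = S.
Proof.
move=> rv vS /properP[sS [w wB wS]].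
pose E := [set e in atoms_in v \top | other v e \in S].
have [|z [vz _ zE]] :=
  @exists_atoms_eq _ _ binP _ Aid v \top E (lex1 v) (len_atom rv).
  by apply/subsetP=> e; rewrite inE => /andP[].
have z1 : z < \top.
  rewrite ltx1; apply/eqP=> z1; have [|e eP we] := block_other rv wB.
    by apply: contraNneq wS => ->.
  have : e \in atoms_in v z by rewrite z1.
  by rewrite zE inE -we (negbTE wS) andbF.
have zP e : e \in atoms_in v \top -> (e <= z) = (other v e \in S).
  move=> eP; have := congr1 (fun T : {set P} => e \in T) zE.
  rewrite [RHS]in_set eP /= => <-; rewrite inE.
  by move: eP; rewrite inE => /andP[-> _].
exists z => //; apply/setP=> u; rewrite mem_atoms //.
have [->|uv] := eqVneq u v; first by rewrite rv vz vS.
apply/andP/idP=> [[/eqP ru uz]|uS].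
  have [|e eP ue] := @block_other v u rv _ uv; last by rewrite ue -zP // (edge_le rv) -?ue.
  by apply/mem_block; split=> //; exists z.
have uB := subsetP sS u uS; have [-> _] := mem_block _ _ uB.
have [e eP ue] := block_other rv uB uv.
by rewrite ue -(edge_le rv) // zP // -ue.
Qed.

(** The position depends on [B u] only as a set, so all members of a class are numbered by one
    common enumeration. *)
Definition label u : 'I_K.+1 := inord (index u (enum (B u))).

Lemma label_inj v : rank v = 1%N -> {in B v &, injective label}.
Proof.
move=> rv u u' uv u'v; rewrite /label (boolean_block_eq rv uv).
rewrite (boolean_block_eq rv u'v) => /(congr1 (@nat_of_ord _)); rewrite !inordK; last 2 first.
- by rewrite -(card_block rv) cardE index_mem mem_enum.
- by rewrite -(card_block rv) cardE index_mem mem_enum.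
by move=> e; rewrite -(nth_index v (s := enum (B v)) (x := u)) ?e ?nth_index ?mem_enum.
Qed.

Lemma label_block v : rank v = 1%N -> label @: B v = [set: 'I_K.+1].
Proof.
move=> rv; apply/eqP; rewrite eqEcard subsetT cardsT card_ord.
by rewrite (card_in_imset (label_inj rv)) card_block ?leqnn.
Qed.

Theorem boolean_sum : exists k, (0 < k)%N /\
  order_isomorphic P (ksum k (boolean_lattice K.+1)).
Proof.
pose h x : boolean_lattice K.+1 := label @: atoms_in \bot x.
have P01 : \bot < \top :> P by rewrite lt_top rank_bot.
have atR v : covers \bot v -> rank v = 1%N by rewrite atom_rank // => /eqP.
have [v0 cv0 _] := exists_atom P01.
have atB u x : x < \top -> u \in atoms_in \bot x -> atoms_in \bot x \subset B u.
  rewrite mem_atoms // => x1 /andP[/eqP ru ux]; apply/subsetP=> w.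
  rewrite mem_atoms // => /andP[/eqP rw wx].
  by apply/mem_block; split=> //; exists x.
apply: (@ksum_isomorphic _ _ P _ h) => //.
- move=> x; rewrite /h; have [->|x0] := eqVneq x \bot.
    by rewrite atoms_inxx imset0; apply/eqP.
  have [u ux] := exists_atom_bot x0; apply/negbTE/eqP.
  by move=> /(congr1 (fun T : {set 'I_K.+1} => label u \in T)); rewrite imset_f // in_set0.
- move=> x; rewrite /h; have [->|x1] := eqVneq x \top.
    apply/eqP; change (label @: atoms_in \bot (\top : P) = [set: 'I_K.+1]).
    apply/eqP; rewrite eqEsubset subsetT -(label_block (atR _ cv0)) imsetS //.
    by apply/subsetP=> u /mem_block[ru _]; rewrite mem_atoms // ru lex1.
  apply/negbTE/eqP=> e; have : #|label @: atoms_in \bot x| = K.+1.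
    by rewrite [label @: _]e cardsT card_ord.
  apply/eqP; rewrite ltn_eqF // ltnS (leq_trans (leq_imset_card _ _)) //.
  by rewrite card_atoms_bot -?lt_top // ltx1.
- by move=> u v /atR; apply: boolean_block_eq.
- move=> u v x y x1 y1 ux vy vu.
  have [cu ux'] : covers \bot u /\ u <= x by apply/andP; rewrite inE in ux.
  have ru := atR u cu.
  rewrite le_atoms //; last exact: lt_le_trans (covers_lt cu) ux'.
  apply/idP/idP=> [sub|/subsetP sub]; first exact: imsetS.
  apply/subsetP=> w wx; have /imsetP[w' w'y ww'] := sub _ (imset_f label wx).
  rewrite (label_inj ru _ _ ww') //; first exact: (subsetP (atB u x x1 ux)).
  by rewrite -(boolean_block_eq ru vu); apply: (subsetP (atB v y y1 vy)).
- move=> v q cv q0 q1; have rv := atR v cv.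
  pose S := [set u in B v | label u \in q].
  have SE : label @: S = q.
    apply/setP=> i; apply/imsetP/idP=> [[u]|iq]; first by rewrite inE => /andP[_ ?] ->.
    have : i \in label @: B v by rewrite label_block.
    by case/imsetP=> u uv iu; exists u; rewrite // inE uv -iu.
  (* A nonempty [q] supplies the atom [u] of [S] at which [exists_atoms_bot] is applied; [q] not
     being full makes [S] proper. *)
  have /set0Pn[i iq] : (q : {set _}) != set0 by [].
  have : i \in label @: S by rewrite SE.
  case/imsetP=> u uS _; have uB : u \in B v by move: uS; rewrite inE => /andP[].
  have [ru _] := mem_block _ _ uB; have Buv := boolean_block_eq rv uB.
  have [|x x1 xE] := exists_atoms_bot ru uS.
    rewrite Buv properEneq; apply/andP; split.
      by apply/eqP=> e; case/eqP: q1; move: SE; rewrite e label_block // => <-.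
    by apply/subsetP=> w; rewrite inE => /andP[].
  by exists u, x; rewrite xE; split=> //; rewrite /h xE.
Qed.

End BooleanSum.

(** * Sums of butterfly posets *)

Section ButterflySum.
Context {d : Order.disp_t} {P : finTBPOrderType d}.
Implicit Types (x y z t u v w : P).
Local Open Scope order_scope.
Variable K : nat.
Hypotheses (binP : binomial_poset P) (rank_top : rank (\top : P) = K.+1)
  (K3 : (3 <= K)%N)
  (A2 : forall k, (2 <= k <= K)%N -> @atom_number _ P k = 2).
Local Notation B := (block (\top : P)).

Lemma block_atoms v z : rank v = 1%N -> v <= z -> z < \top -> (2 <= rank z)%N ->
  B v = atoms_in \bot z.
Proof. by move=> rv vz z1 rz; apply: (block_butterfly binP A2 K3). Qed.

Lemma exists_edge_above v : rank v = 1%N ->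
  exists z, [/\ v <= z, z < \top & rank z = 2].
Proof.
move=> rv; have [|z [vz _ rz]] := @exists_rank _ _ binP v \top 2 (lex1 v).
  by rewrite rv rank_top; lia.
by exists z; split=> //; rewrite (lt_top binP rank_top) rz (ltnW K3).
Qed.

Lemma card_butterfly_block v : rank v = 1%N -> #|B v| = 2.
Proof.
move=> rv; have [z [vz z1 rz]] := exists_edge_above rv.
rewrite (block_atoms rv vz z1) ?rz // card_atoms ?le0x // rank_bot // rz A2 //.
exact: ltnW.
Qed.

Lemma butterfly_block_eq u v : rank v = 1%N -> u \in B v -> B u = B v.
Proof.
move=> rv; have [z [vz z1 rz]] := exists_edge_above rv.
rewrite (block_atoms rv vz z1) ?rz // mem_atoms // => /andP[/eqP ru uz].
by rewrite (block_atoms ru uz z1) ?rz.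
Qed.

Definition rank_level v (r : nat) : {set P} :=
  [set z | (rank z == r) && (block_of z == B v)].

Lemma block_of_atom v z : rank v = 1%N -> v <= z -> z < \top -> block_of z = B v.
Proof.
move=> rv vz z1; apply: block_ofE => //; last by rewrite mem_atoms // rv.
by move=> u w; rewrite atom_rank // => /eqP; apply: butterfly_block_eq.
Qed.

Lemma butterfly_blockxx v : rank v = 1%N -> v \in B v.
Proof.
move=> rv; apply: block_refl; first by rewrite atom_rank // rv.
by rewrite (lt_top binP rank_top) rv; lia.
Qed.

(** In rank 1 this is the class itself. In rank [r >= 2] it is level [r.-1] of [[v, \top]], because
    an element of that rank lies above every atom of its class. *)
Lemma card_rank_level v r : rank v = 1%N -> (0 < r <= K)%N -> #|rank_level v r| = 2.
Proof.
move=> rv /andP[r0 rK]; have [r1|r2] := leqP r 1.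
  rewrite -(card_butterfly_block rv); apply: eq_card => u; rewrite in_set.
  have -> : r = 1%N by lia.
  apply/andP/idP=> [[/eqP ru /eqP]|uv].
    rewrite (block_of_atom ru) // => [<-|]; first exact: butterfly_blockxx.
    by rewrite (lt_top binP rank_top) ru; lia.
  have ru : rank u = 1%N by move: uv; rewrite inE atom_rank // => /andP[/eqP].
  rewrite ru (block_of_atom ru) ?(butterfly_block_eq rv uv) //.
  by rewrite (lt_top binP rank_top) ru; lia.
have len : (rank (\top : P) - rank v = K)%N by rewrite rank_top rv subn1.
have := @card_level_butterfly _ _ binP K A2 v \top r.-1 (lex1 v); rewrite len.
move=> /(_ (leqnn K)) <-; last lia.
apply: eq_card => z; rewrite levelE in_set lex1 /= rv add1n prednK // andbC.
case: (rank z =P r) => [rz|]; rewrite ?andbF // !andbT.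
have z1 : z < \top by rewrite (lt_top binP rank_top) rz.
apply/eqP/idP=> [zv|vz]; last exact: block_of_atom.
have z0 : z != \bot by apply/eqP=> z0; move: rz; rewrite z0 rank_bot //; lia.
have [u] := exists_atom_bot z0; rewrite mem_atoms // => /andP[/eqP ru uz].
have := butterfly_blockxx rv; rewrite -zv (block_of_atom ru uz z1).
by rewrite (block_atoms ru uz z1) ?rz // mem_atoms // => /andP[].
Qed.

(** The [pick] depends only on the rank and class of [x], so it selects the same one of the two
    candidates for both: that one gets [false], the other [true]. The guard gives [false] at [\bot]
    and [\top]. *)
Definition bit x : bool :=
  (0 < rank x < K.+1)%N &&
  ([pick z | (rank z == rank x) && (block_of z == block_of x)] != Some x).

Lemma bitP x : (0 < (inord (rank x) : 'I_K.+2, bit x).1 < K.+1)%N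
  || ~~ (inord (rank x) : 'I_K.+2, bit x).2.
Proof.
rewrite /= inordK; last by rewrite ltnS -rank_top (le_rank binP) ?lex1.
by rewrite /bit; case: (_ < _ < _)%N.
Qed.

Definition to_butterfly x : butterfly K.+1 := Butterfly (bitP x).

Lemma to_butterfly_rank x : (val (to_butterfly x)).1 = rank x :> nat.
Proof. by rewrite /= inordK // ltnS -rank_top (le_rank binP) ?lex1. Qed.

Lemma to_butterfly_inj v x y : rank v = 1%N -> rank x = rank y ->
    (0 < rank x <= K)%N -> block_of x = B v -> block_of y = B v -> bit x = bit y ->
  x = y.
Proof.
move=> rv rxy rx xv yv; have c2 := card_rank_level rv rx.
rewrite /bit -rxy ltnS rx /= xv yv; case: pickP => [p /andP[rp pv]|/(_ x)]; last first.
  by rewrite xv !eqxx.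
have xL : x \in rank_level v (rank x) by rewrite inE eqxx xv eqxx.
have yL : y \in rank_level v (rank x) by rewrite inE rxy eqxx yv eqxx.
have pL : p \in rank_level v (rank x) by rewrite inE rp pv.
rewrite !(inj_eq Some_inj); have [->|px] := eqVneq p x.
  by move/esym/negbFE/eqP.
have [_|py] := eqVneq p y; first by [].
(* Otherwise [p], [x] and [y] would be three distinct elements of a level of size 2. *)
move=> _; apply/eqP; apply: contraLR (leqnn 2) => xy; rewrite -{1}c2 -ltnNge.
have <- : #|p |: [set x; y]| = 3 by rewrite cardsU1 cards2 !inE negb_or px py xy.
by apply: subset_leq_card; apply/subsetP=> z; rewrite !in_setU1 in_set1 => /or3P[] /eqP->.
Qed.

Theorem butterfly_sum : exists k, (0 < k)%N /\
  order_isomorphic P (ksum k (butterfly K.+1)).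
Proof.
have ltT := lt_top binP rank_top.
have P01 : \bot < \top :> P by rewrite ltT rank_bot.
have atR v : covers \bot v -> rank v = 1%N by rewrite atom_rank // => /eqP.
have rk0 x : rank x = 0%N -> x = \bot.
  by move=> r0; apply/esym/(le_rank_eq binP (le0x x)); rewrite r0.
have rkT x : rank x = K.+1 -> x = \top.
  by move=> r0; apply/(le_rank_eq binP (lex1 x)); rewrite r0 rank_top.
have bE x (y : butterfly K.+1) : (to_butterfly x == y) = ((rank x == (val y).1) && (bit x == (val y).2)).
  rewrite -val_eqE /=; case: (val y) => i b /=; rewrite xpair_eqE -val_eqE /=.
  by rewrite inordK // ltnS -rank_top (le_rank binP) ?lex1.
apply: (@ksum_isomorphic _ _ P _ to_butterfly) => //.
- move=> x; rewrite bE /=; have [->|x0] := eqVneq x \bot.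
    by rewrite rank_bot // /bit rank_bot.
  by apply/negP=> /andP[/eqP/rk0 e _]; case/eqP: x0.
- move=> x; rewrite bE /=; have [->|x0] := eqVneq x \top.
    by rewrite rank_top /bit rank_top ltnn !andbF !eqxx.
  by apply/negP=> /andP[/eqP/rkT e _]; case/eqP: x0.
- by move=> u v /atR; apply: butterfly_block_eq.
- move=> u v x y x1 y1; rewrite !mem_atoms // => /andP[/eqP ru ux] /andP[/eqP rv vy] vu.
  have Buv := butterfly_block_eq ru vu.
  have bx := block_of_atom ru ux x1; have by' := block_of_atom rv vy y1.
  have rx : (0 < rank x <= K)%N by rewrite -ltT x1 -ru (le_rank binP).
  rewrite [RHS]/Order.le /= /butterfly_le !to_butterfly_rank.
  apply/idP/orP=> [|[|]].
  + by rewrite le_eqVlt => /predU1P[->|/(lt_rank binP)]; [left|right].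
  + rewrite bE to_butterfly_rank /= => /andP[/eqP rxy /eqP bxy].
    by rewrite (to_butterfly_inj ru rxy) // by' Buv.
  (* Since [y] has rank at least 2, its atoms form the whole class, so [u <= y] and the comparison
     takes place in [[u, \top]]. *)
  move=> rxy; have ry : (2 <= rank y)%N by lia.
  have uy : u <= y.
    have := butterfly_blockxx ru; rewrite -Buv (block_atoms rv vy) //.
    by rewrite mem_atoms // => /andP[].
  by apply: (le_butterfly binP A2 (x := u) (y := \top)); rewrite ?lex1 // rank_top ru subn1.
move=> v q cv q0 q1; have rv := atR v cv; case: q q0 q1 => -[r b] rb q0 q1.
have rK : (0 < r <= K)%N.
  have := rb; rewrite /= -ltnS; have [//|rN /= b0] := boolP (0 < r < K.+1)%N.
  have [r0|rT] : (r : nat) = 0%N \/ (r : nat) = K.+1 by have := ltn_ord r; lia.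
    case/eqP: q0; apply: val_inj; congr (_, _); last exact: negbTE.
    exact: val_inj.
  case/eqP: q1; apply: val_inj; congr (_, _); last exact: negbTE.
  exact: val_inj.
have c2 := card_rank_level rv rK.
have [p pE pL] : exists2 p,
    [pick z | (rank z == r) && (block_of z == B v)] = Some p & p \in rank_level v r.
  case: pickP => [p pP|none]; first by exists p; rewrite // inE.
  have : #|rank_level v r| = 0%N by apply: eq_card0 => z; rewrite inE none.
  by rewrite c2.
(* The bit [b] decides between the selected element [p] and the other one of its level. *)
have [x xL xb] : exists2 x, x \in rank_level v r & (p != x) = b.
  case: (b); last by exists p; rewrite ?eqxx.
  have : (0 < #|rank_level v r :\ p|)%N by have := cardsD1 p (rank_level v r); rewrite pL c2; lia.
  by case/card_gt0P=> x; rewrite in_setD1 => /andP[xp xL]; exists x; rewrite // eq_sym.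
move: xL; rewrite inE => /andP[/eqP rx /eqP xv].
have x1 : x < \top by rewrite ltT rx; case/andP: rK.
have x0 : x != \bot by apply/eqP=> x0; move: rx; rewrite x0 rank_bot //; lia.
have [u ux] := exists_atom_bot x0; exists u, x; split=> //.
  move: ux; rewrite mem_atoms // => /andP[/eqP ru ux].
  by rewrite -xv (block_of_atom ru ux x1) butterfly_blockxx.
apply/eqP; rewrite bE /= rx eqxx /bit rx xv ltnS rK pE (inj_eq Some_inj) xb /=.
exact: eqxx.
Qed.

End ButterflySum.

Theorem theorem3p12 (d : Order.disp_t) (P : finTBPOrderType d) (n m : nat)
  (eulP : eulerian P) (binP : binomial_poset P) (rankP : rank (\top%O : P) = n)
  (n_odd : n = 2 * m + 1) (n_ge5 : 5 <= n) :
  exists k : nat, 0 < k /\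
    (order_isomorphic P (ksum k (boolean_lattice n)) \/
     order_isomorphic P (ksum k (butterfly n))).
Proof.
have nE : n = m.*2.+1 by lia.
have m2 : 2 <= m by lia.
have K3 : 3 <= m.*2 by lia.
have [] := atom_number_dichotomy binP eulP m2; first by rewrite rankP nE.
all: rewrite nE in rankP * => Ak.
  by have [k [k0 iso]] := boolean_sum binP rankP K3 Ak; exists k; split=> //; left.
by have [k [k0 iso]] := butterfly_sum binP rankP K3 Ak; exists k; split=> //; right.
Qed.
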